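(* Let $L$ be a frame. The following statements are equivalent. (1) The sum of every two $z_r$-ideals in $\mathcal{R}L$ is a $z_r$-ideal or all of $\mathcal{R}L$, and of any two ideals in $\mathcal{R}L$ whose sum is a proper $z_r$-ideal, at least one is a $z_r$-ideal. (2) $L$ is a $P_F$-frame. (3) Of any two ideals in $\mathcal{R}L$ whose intersection is a $z_r$-ideal, at least one is a $z_r$-ideal.
   Context: A frame is a complete lattice $L$ (top $1$, bottom $0$) satisfying $a\wedge\bigvee S=\bigvee\{a\wedge s\mid s\in S\}$ for all $a\in L$, $S\subseteq L$. Throughout, all frames are assumed completely regular: $a=\bigvee\{x\mid x\prec\!\prec a\}$ for all $a$, where $a\prec b$ means there is $t$ with $a\wedge t=0$, $t\vee b=1$, and $a\prec\!\prec b$ means there is a family $(c_q)_{q\in\mathbb{Q}\cap[0,1]}$ with $c_0=a$, $c_1=b$, $c_r\prec c_s$ for $r<s$. An element $a$ is complemented if $a\vee a^*=1$, where $a^*=\bigvee\{x\in L\mid x\wedge a=0\}$. $\mathcal{L}(\mathbb{R})$ is the frame of reals, generated by pairs $(p,q)$ of rationals subject to $(p,q)\wedge(r,s)=(p\vee r,q\wedge s)$; $(p,q)\vee(r,s)=(p,s)$ when $p\le r<q\le s$; $(p,q)=\bigvee\{(r,s)\mid p<r<s<q\}$; $1=\bigvee\{(p,q)\mid p,q\in\mathbb{Q}\}$. $\mathcal{R}L$ is the ring of real-valued continuous functions on $L$: the set of frame homomorphisms $\mathcal{L}(\mathbb{R})\to L$, a commutative ring with identity under $(\varphi\diamond\psi)(p,q)=\bigvee\{\varphi(r,s)\wedge\psi(t,u)\mid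 x\diamond y\in(p,q)\text{ for all rationals }x\in(r,s),\,y\in(t,u)\}$ for $\diamond\in\{+,\cdot\}$. For $\varphi\in\mathcal{R}L$, $\mathrm{coz}\,\varphi=\bigvee\{\varphi(p,0)\vee\varphi(0,q)\mid p,q\in\mathbb{Q}\}$, and $\mathrm{Coz}\,L=\{\mathrm{coz}\,\varphi\mid\varphi\in\mathcal{R}L\}$. $L$ is a $P_F$-frame if whenever $a,b\in\mathrm{Coz}\,L$ satisfy $a\wedge b=0$, at least one of $a,b$ is complemented. An ideal $I$ of $\mathcal{R}L$ is a $z$-ideal if for any $\alpha\in\mathcal{R}L$ and $\varphi\in I$, $\mathrm{coz}\,\alpha=\mathrm{coz}\,\varphi$ implies $\alpha\in I$. It is an $r$-ideal if for each $\alpha\in\mathcal{R}L$ and each regular element (non-zero-divisor) $\varphi$ of $\mathcal{R}L$, $\alpha\varphi\in I$ implies $\alpha\in I$. It is a $z_r$-ideal if it is both a $z$-ideal and an $r$-ideal. *)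

(* Defs.v *)
From HB Require Import structures.
From mathcomp Require Import all_boot all_order all_algebra.
From mathcomp Require Import boolp classical_sets.
From mathcomp Require Import ring lra.
Set Bullet Behavior "Strict Subproofs".

Set Implicit Arguments.
Unset Strict Implicit.
Unset Printing Implicit Defensive.

Import Order.TTheory GRing.Theory Num.Theory.

Local Open Scope classical_set_scope.
Local Open Scope order_scope.

Local Ltac minmax := rewrite /Order.max /Order.min; 
  repeat match goal with |- context [if (?x < ?y)%O then _ else _] =>
    case: (ltP x y) => ? end; intros; try lra.

HB.mixin Record TBLattice_isFrame d L of Order.TBLattice d L := {
  bigjoin : set L -> L;
  le_bigjoin_sub : forall (S : set L) x, S x -> x <= bigjoin S;
  bigjoin_le_sub : forall (S : set L) y, (forall x, S x -> x <= y) -> bigjoin S <= y;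
  meetx_bigjoin_sub : forall x (S : set L),
    x `&` bigjoin S = bigjoin [set x `&` s | s in S]
}.

#[short(type="frameType")]
HB.structure Definition Frame d :=
  { L of Order.TBLattice d L & TBLattice_isFrame d L }.

Record frameHom d d' (M : frameType d) (L : frameType d') := FrameHom {
  frame_hom :> M -> L;
  frame_homT : frame_hom \top = \top;
  frame_homI : {morph frame_hom : x y / x `&` y};
  frame_hom_sup : forall S, frame_hom (bigjoin S) = bigjoin [set frame_hom x | x in S]
}.

Section FrameNotions.
Context {d : Order.disp_t} {L : frameType d}.
Implicit Types a b x y : L.

Definition pseudocompl a : L := bigjoin [set x | x `&` a = \bot].

Definition complemented a : Prop := a `|` pseudocompl a = \top.

Definition rather_below a b : Prop :=
  exists t, a `&` t = \bot /\ t `|` b = \top.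

Definition completely_below a b : Prop :=
  exists c : rat -> L, [/\ c 0%R = a, c 1%R = b &
    forall r s : rat, 0%R <= r -> r < s -> s <= 1%R -> rather_below (c r) (c s)].

End FrameNotions.

Definition completely_regular d (L : frameType d) : Prop :=
  forall a : L, a = bigjoin [set x | completely_below x a].

Section FrameTheory.
Context {d : Order.disp_t} {L : frameType d}.
Implicit Types (x y z : L) (S T : set L).

Lemma le_bigjoin S x : S x -> x <= bigjoin S.
Proof. exact: le_bigjoin_sub. Qed.

Lemma bigjoin_le S y : (forall x, S x -> x <= y) -> bigjoin S <= y.
Proof. exact: bigjoin_le_sub. Qed.

Lemma le_bigjoint S x y : S x -> y <= x -> y <= bigjoin S.
Proof. by move=> Sx yx; apply: (le_trans yx); exact: le_bigjoin. Qed.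

Lemma meetx_bigjoin x S : x `&` bigjoin S = bigjoin [set x `&` s | s in S].
Proof. exact: meetx_bigjoin_sub. Qed.

Lemma meet_bigjoin_le x S y : (forall s, S s -> x `&` s <= y) -> x `&` bigjoin S <= y.
Proof.
by move=> H; rewrite meetx_bigjoin; apply: bigjoin_le => _ [s Ss <-]; exact: H.
Qed.

Lemma bigjoin_meetl_le x S y : (forall s, S s -> s `&` x <= y) -> bigjoin S `&` x <= y.
Proof. by move=> H; rewrite meetC; apply: meet_bigjoin_le => s /H; rewrite meetC. Qed.

Lemma bigjoin_meet_le S T y :
  (forall s t, S s -> T t -> s `&` t <= y) -> bigjoin S `&` bigjoin T <= y.
Proof.
by move=> H; apply: bigjoin_meetl_le => s Ss; apply: meet_bigjoin_le => t Tt; exact: H.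
Qed.

Lemma join_bigjoin x y : x `|` y = bigjoin [set z | z = x \/ z = y].
Proof.
apply/eqP; rewrite eq_le; apply/andP; split.
  by rewrite leUx; apply/andP; split; apply: le_bigjoin; [left|right].
by apply: bigjoin_le => z [->|->]; rewrite ?leUl ?leUr.
Qed.

Lemma meet_join_le x y z t :
  x `&` y <= t -> x `&` z <= t -> x `&` (y `|` z) <= t.
Proof. by move=> xy xz; rewrite join_bigjoin; apply: meet_bigjoin_le => _ [->|->]. Qed.

End FrameTheory.

Section RealRelations.
Context {d : Order.disp_t} {L : frameType d}.

Record real_relations (f : rat -> rat -> L) : Prop := RealRelations {
  realrel_meet : forall p q r s : rat,
    f p q `&` f r s = f (Order.max p r) (Order.min q s);
  realrel_join : forall p q r s : rat, p <= r -> r < q -> q <= s ->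
    f p q `|` f r s = f p s;
  realrel_sup : forall p q : rat,
    f p q = bigjoin [set x | exists r s, [/\ p < r, r < s, s < q & x = f r s]];
  realrel_top : \top = bigjoin [set x | exists p q, x = f p q]
}.

End RealRelations.

(* The frame of reals, i.e. the frame presented by generators (p, q) subject to
   [real_relations], is realised as the frame of those sets of generators that
   are closed under the relations (read as a coverage).  [realrel_gen],
   [real_ofK] and [real_of_uniq] establish the universal property of the
   presentation: maps respecting the relations extend uniquely to frame
   homomorphisms. *)
Record real_closed (U : set (rat * rat)) : Prop := RealClosed {
  rclosed_down : forall p q r s : rat, p <= r -> s <= q -> U (p, q) -> U (r, s);
  rclosed_join : forall p q r s : rat, p <= r -> r < q -> q <= s ->
    U (p, q) -> U (r, s) -> U (p, s);
  rclosed_sup : forall p q : rat,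
    (forall r s : rat, p < r -> r < s -> s < q -> U (r, s)) -> U (p, q)
}.

Record reals := Reals {
  reals_set :> set (rat * rat);
  reals_closed : real_closed reals_set
}.

HB.instance Definition _ := gen_eqMixin reals.
HB.instance Definition _ := gen_choiceMixin reals.

Lemma reals_inj (U V : reals) : (U : set _) = V -> U = V.
Proof.
case: U V => [U cU] [V cV] /= UV; case: V / UV cV => cV.
by congr Reals; exact: Prop_irrelevance.
Qed.

Definition reals_le (U V : reals) : bool := `[< (U : set _) `<=` V >].

Fact reals_display : Order.disp_t. Proof. exact: (Order.Disp tt tt). Qed.

Fact reals_le_refl : reflexive reals_le.
Proof. by move=> U; apply/asboolP. Qed.

Fact reals_le_anti : antisymmetric reals_le.
Proof.
move=> U V /andP[/asboolP UV /asboolP VU].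
by apply: reals_inj; apply/seteqP.
Qed.

Fact reals_le_trans : transitive reals_le.
Proof.
by move=> V U W /asboolP UV /asboolP VW; apply/asboolP; exact: subset_trans VW.
Qed.

HB.instance Definition _ := Order.Le_isPOrder.Build reals_display reals
  reals_le_refl reals_le_anti reals_le_trans.

Lemma reals_leP (U V : reals) : reflect ((U : set _) `<=` V) (U <= V).
Proof. exact: asboolP. Qed.

Lemma real_closedI (U V : set (rat * rat)) :
  real_closed U -> real_closed V -> real_closed (U `&` V)%classic.
Proof.
move=> [U1 U2 U3] [V1 V2 V3]; split.
- by move=> p q r s pr sq [? ?]; split; [apply: U1 pr sq _|apply: V1 pr sq _].
- move=> p q r s pr rq qs [? ?] [? ?].
  by split; [apply: U2 pr rq qs _ _|apply: V2 pr rq qs _ _].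
- move=> p q H; split; [apply: U3|apply: V3] => r s pr rs sq.
    by have [] := H r s pr rs sq.
  by have [] := H r s pr rs sq.
Qed.

Lemma real_closedT : real_closed [set: rat * rat].
Proof. by []. Qed.

Definition reals_cl (A : set (rat * rat)) : set (rat * rat) :=
  [set x | forall U, real_closed U -> A `<=` U -> U x].

Lemma reals_cl_closed A : real_closed (reals_cl A).
Proof.
split.
- move=> p q r s pr sq H U cU AU.
  by apply: (rclosed_down cU pr sq); exact: H.
- move=> p q r s pr rq qs H H' U cU AU.
  by apply: (rclosed_join cU pr rq qs); [exact: H|exact: H'].
- move=> p q H U cU AU; apply: (rclosed_sup cU) => r s pr rs sq.
  exact: (H r s).
Qed.

Definition reals_span (A : set (rat * rat)) : reals :=
  Reals (reals_cl_closed A).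

Lemma sub_reals_span A : A `<=` reals_span A.
Proof. by move=> x Ax U cU; exact. Qed.

Lemma reals_span_le A (U : reals) : A `<=` U -> reals_span A <= U.
Proof. by move=> AU; apply/reals_leP => x; apply => //; exact: reals_closed. Qed.

Definition reals_meet (U V : reals) : reals :=
  Reals (real_closedI (reals_closed U) (reals_closed V)).

Definition reals_join (U V : reals) : reals :=
  reals_span ((U : set _) `|` V)%classic.

Definition reals_top : reals := Reals real_closedT.

Definition reals_bot : reals := reals_span set0.

Definition reals_sup (S : set reals) : reals :=
  reals_span [set x | exists2 U, S U & (U : set _) x].

Fact reals_lexI (U V W : reals) :
  (U <= reals_meet V W) = (U <= V) && (U <= W).
Proof.
apply/reals_leP/andP => [H|[/reals_leP UV /reals_leP UW] x Ux]; last first.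
  by split; [exact: UV|exact: UW].
by split; apply/reals_leP => x /H [].
Qed.

Fact reals_leUx (U V W : reals) :
  (reals_join U V <= W) = (U <= W) && (V <= W).
Proof.
apply/idP/andP => [/reals_leP H|[/reals_leP UV /reals_leP UW]].
  by split; apply/reals_leP => x ?; apply: H; apply: sub_reals_span; [left|right].
by apply: reals_span_le => x [/UV|/UW].
Qed.

HB.instance Definition _ := Order.POrder_MeetJoin_isLattice.Build
  reals_display reals reals_lexI reals_leUx.

Fact reals_le0x (U : reals) : reals_bot <= U.
Proof. exact: reals_span_le. Qed.

Fact reals_lex1 (U : reals) : U <= reals_top.
Proof. exact/reals_leP. Qed.

HB.instance Definition _ := Order.hasBottom.Build reals_display reals reals_le0x.
HB.instance Definition _ := Order.hasTop.Build reals_display reals reals_lex1.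


Lemma real_closed_capI (U : set (rat * rat)) (t u : rat) : real_closed U ->
  real_closed [set x | U (Order.max t x.1, Order.min u x.2)].
Proof.
move=> cU; split=> /=.
- move=> p q r s pr sq; apply: (rclosed_down cU); minmax.
- move=> p q r s pr rq qs H1 H2.
  have [rq'|rq'] := leP (Order.min u q) (Order.max t r); last first.
    apply: (rclosed_join cU _ rq' _ H1 H2); minmax.
  have [ur|ur] := leP u r; first by apply: (rclosed_down cU _ _ H1); minmax.
  have [qt|qt] := leP q t; first by apply: (rclosed_down cU _ _ H2); minmax.
  apply: (rclosed_sup cU) => x y tx xy yu; exfalso.
  move: rq' tx yu; rewrite ge_min !le_max !gt_max !lt_min => H12.
  move=> /andP[tx px] /andP[yu ys].
  by case/orP: H12 => /orP[] ?; lra.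
- move=> p q H; apply: (rclosed_sup cU) => r s pr rs sq.
  move: pr sq; rewrite gt_max lt_min => /andP[tr pr] /andP[su sq].
  by have := H r s pr rs sq; rewrite (max_r (ltW tr)) (min_r (ltW su)).
Qed.

Fact reals_meet_sup (U : reals) (S : set reals) :
  reals_meet U (reals_sup S) = reals_sup [set reals_meet U V | V in S].
Proof.
apply/eqP; rewrite eq_le; apply/andP; split; last first.
  apply: reals_span_le => x [_ [V SV <-]] [Ux Vx]; split=> //.
  by apply: sub_reals_span; exists V.
pose T := reals_sup [set reals_meet U V | V in S].
apply/reals_leP => -[p q] [Upq Spq]; rewrite -/T.
have cT t u := real_closed_capI t u (reals_closed T).
suff : [set x | (T : set _) (Order.max p x.1, Order.min q x.2)] (p, q).
  by rewrite /= maxxx minxx.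
apply: Spq => // -[t u] [V SV Vtu] /=.
apply: sub_reals_span; exists (reals_meet U V); first by exists V.
split.
- by apply: (rclosed_down (reals_closed U) _ _ Upq); minmax.
- by apply: (rclosed_down (reals_closed V) _ _ Vtu); minmax.
Qed.

Fact le_reals_sup (S : set reals) U : S U -> U <= reals_sup S.
Proof. by move=> SU; apply/reals_leP => x Ux; apply: sub_reals_span; exists U. Qed.

Fact reals_sup_le (S : set reals) U :
  (forall V, S V -> V <= U) -> reals_sup S <= U.
Proof. by move=> H; apply: reals_span_le => x [V /H/reals_leP VU Vx]; exact: VU. Qed.

HB.instance Definition _ := TBLattice_isFrame.Build reals_display reals
  le_reals_sup reals_sup_le reals_meet_sup.

Definition real_gen (p q : rat) : reals := reals_span [set (p, q)].

Lemma real_gen_in p q : (real_gen p q : set _) (p, q).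
Proof. exact: sub_reals_span. Qed.

Lemma real_gen_le p q (U : reals) : (real_gen p q <= U) <-> (U : set _) (p, q).
Proof.
split=> [/reals_leP|H]; first by apply; exact: real_gen_in.
by apply: reals_span_le => x ->.
Qed.

Lemma real_gen_mono (p q r s : rat) : p <= r -> s <= q -> real_gen r s <= real_gen p q.
Proof.
move=> pr sq; apply/real_gen_le.
exact: (rclosed_down (reals_closed (real_gen p q)) pr sq (@real_gen_in p q)).
Qed.

Lemma reals_supE (U : reals) :
  U = bigjoin [set x | exists p q, (U : set _) (p, q) /\ x = real_gen p q].
Proof.
apply/eqP; rewrite eq_le; apply/andP; split; last first.
  by apply: bigjoin_le => _ [p [q [Upq ->]]]; apply/real_gen_le.
apply/reals_leP => -[p q] Upq.
apply/real_gen_le; apply: le_bigjoin; by exists p, q.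
Qed.

Lemma realrel_gen : real_relations real_gen.
Proof.
split.
- move=> p q r s; apply/eqP; rewrite eq_le; apply/andP; split; last first.
    by rewrite lexI; apply/andP; split; apply: real_gen_mono; minmax.
  apply/reals_leP => -[t u] [H1 H2].
  have := real_gen_in (p := Order.max p r) (q := Order.min q s).
  move: (real_gen _ _) => V VI; have cV := reals_closed V.
  suff : [set x | (V : set _) (Order.max t x.1, Order.min u x.2)] (t, u).
    by rewrite /= maxxx minxx.
  apply: H2; first exact: real_closed_capI.
  move=> _ -> /=; rewrite maxC minC.
  have : [set x | (V : set _) (Order.max r x.1, Order.min s x.2)] (t, u).
    apply: H1; first exact: real_closed_capI.
    by move=> _ -> /=; rewrite maxC minC.
  by rewrite /= maxC minC.
- move=> p q r s pr rq qs; apply/eqP; rewrite eq_le; apply/andP; split.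
    by rewrite leUx !real_gen_mono //; lra.
  apply/real_gen_le; apply: (rclosed_join (reals_closed _) pr rq qs).
    by apply/real_gen_le; exact: leUl.
  by apply/real_gen_le; exact: leUr.
- move=> p q; apply/eqP; rewrite eq_le; apply/andP; split; last first.
    by apply: bigjoin_le => _ [r [s [pr rs sq ->]]]; apply: real_gen_mono; lra.
  apply/real_gen_le; apply: (rclosed_sup (reals_closed _)) => r s pr rs sq.
  by apply/real_gen_le; apply: le_bigjoin; exists r, s.
- apply/eqP; rewrite eq_le lex1 andbT; apply/reals_leP => -[p q] _.
  by apply/real_gen_le; apply: le_bigjoin; exists p, q.
Qed.

Section UniversalProperty.
Context {d : Order.disp_t} {L : frameType d}.

Section RealOf.
Variables (f : rat -> rat -> L) (fP : real_relations f).

Lemma realrel_mono (p q r s : rat) : p <= r -> s <= q -> f r s <= f p q.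
Proof.
move=> pr sq; suff -> : f r s = f p q `&` f r s by exact: leIl.
by rewrite (realrel_meet fP); congr f; minmax.
Qed.

Definition real_of_fun (U : reals) : L :=
  bigjoin [set x | exists p q, (U : set _) (p, q) /\ x = f p q].

Lemma real_closed_below y : real_closed [set x | f x.1 x.2 <= y].
Proof.
split=> /=.
- move=> p q r s pr sq; apply: le_trans; exact: realrel_mono.
- move=> p q r s pr rq qs H1 H2.
  by rewrite -(realrel_join fP pr rq qs) leUx H1.
- move=> p q H; rewrite (realrel_sup fP); apply: bigjoin_le.
  by move=> _ [r [s [? ? ? ->]]]; exact: H.
Qed.

Lemma real_of_fun_span A y :
  (forall p q, A (p, q) -> f p q <= y) -> real_of_fun (reals_span A) <= y.
Proof.
move=> H; apply: bigjoin_le => _ [p [q [Apq ->]]].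
by apply: (Apq _ (real_closed_below y)) => -[r s]; exact: H.
Qed.

Fact real_of_funT : real_of_fun \top = \top.
Proof.
apply/eqP; rewrite eq_le lex1 /= [X in X <= _](realrel_top fP).
by apply: bigjoin_le => _ [p [q ->]]; apply: le_bigjoin; exists p, q.
Qed.

Fact real_of_funI : {morph real_of_fun : U V / U `&` V}.
Proof.
move=> U V; apply/eqP; rewrite eq_le; apply/andP; split.
  rewrite lexI; apply/andP; split; apply: bigjoin_le => _ [p [q [[Up Vp] ->]]];
  by apply: le_bigjoin; exists p, q.
apply: bigjoin_meet_le => _ _ [p [q [Up ->]]] [r [s [Vr ->]]].
rewrite (realrel_meet fP); apply: le_bigjoin; eexists; eexists; split; last by [].
split.
- by apply: (rclosed_down (reals_closed U) _ _ Up); minmax.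
- by apply: (rclosed_down (reals_closed V) _ _ Vr); minmax.
Qed.

Fact real_of_fun_sup (S : set reals) :
  real_of_fun (bigjoin S) = bigjoin [set real_of_fun U | U in S].
Proof.
apply/eqP; rewrite eq_le; apply/andP; split.
  apply: real_of_fun_span => p q [U SU Upq].
  apply: (le_bigjoint (x := real_of_fun U)); first by exists U.
  by apply: le_bigjoin; exists p, q.
apply: bigjoin_le => _ [U SU <-]; apply: bigjoin_le => _ [p [q [Up ->]]].
apply: le_bigjoin; exists p, q; split=> //.
by apply: (reals_leP _ _ (le_bigjoin SU)).
Qed.

Definition real_of : frameHom reals L :=
  FrameHom real_of_funT real_of_funI real_of_fun_sup.

Lemma real_ofK p q : real_of (real_gen p q) = f p q.
Proof.
apply/eqP; rewrite eq_le; apply/andP; split.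
  by apply: real_of_fun_span => _ _ [-> ->].
by apply: le_bigjoin; exists p, q; split=> //; exact: real_gen_in.
Qed.

End RealOf.

Lemma frame_hom_mono (d' : Order.disp_t) (M : frameType d') (h : frameHom M L) :
  {homo h : x y / x <= y}.
Proof. by move=> x y /meet_idPl xy; rewrite -xy frame_homI leIr. Qed.

Lemma frame_hom_inj (d' : Order.disp_t) (M : frameType d') (g h : frameHom M L) :
  g =1 h -> g = h.
Proof.
case: g h => [g g1 g2 g3] [h h1 h2 h3] /= /funext gh.
by subst h; congr FrameHom; exact: Prop_irrelevance.
Qed.

Lemma frame_hom_join (d' : Order.disp_t) (M : frameType d') (h : frameHom M L) :
  {morph h : x y / x `|` y}.
Proof.
move=> x y; rewrite !join_bigjoin frame_hom_sup; congr bigjoin.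
apply/seteqP; split=> [_ [z [->|->] <-]|_ [->|->]]; [by left|by right|..].
- by exists x => //; left.
- by exists y => //; right.
Qed.

Lemma real_of_uniq (g h : frameHom reals L) :
  (forall p q, g (real_gen p q) = h (real_gen p q)) -> g = h.
Proof.
move=> gh; apply: frame_hom_inj => U; rewrite (reals_supE U) !frame_hom_sup.
congr bigjoin; apply/seteqP; split=> _ [_ [p [q [Up ->]]] <-];
by exists (real_gen p q) => //; exists p, q.
Qed.

Lemma realrel_hom (h : frameHom reals L) :
  real_relations (fun p q => h (real_gen p q)).
Proof.
have [G1 G2 G3 G4] := realrel_gen; split.
- by move=> p q r s; rewrite -frame_homI G1.
- by move=> p q r s pr rq qs; rewrite -frame_hom_join (G2 _ _ _ _ pr rq qs).
- move=> p q; rewrite G3 frame_hom_sup; congr bigjoin; apply/seteqP; split.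
    by move=> _ [_ [r [s [? ? ? ->]]] <-]; exists r, s.
  by move=> _ [r [s [? ? ? ->]]]; exists (real_gen r s) => //; exists r, s.
- rewrite -(frame_homT h) G4 frame_hom_sup; congr bigjoin; apply/seteqP; split.
    by move=> _ [_ [r [s ->]] <-]; exists r, s.
  by move=> _ [r [s ->]]; exists (real_gen r s) => //; exists r, s.
Qed.

End UniversalProperty.

(* Elements of [RL L] are the frame homomorphisms from the frame of reals to L;
   [rl_at phi p q] is phi(p, q). *)
Definition RL d (L : frameType d) : Type := frameHom reals L.

HB.instance Definition _ d (L : frameType d) := gen_eqMixin (RL L).
HB.instance Definition _ d (L : frameType d) := gen_choiceMixin (RL L).

Definition rl_at d (L : frameType d) (phi : RL L) (p q : rat) : L :=
  frame_hom phi (real_gen p q).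

Section RLTheory.
Context {d : Order.disp_t} {L : frameType d}.
Implicit Types phi psi chi : RL L.
Local Notation at_ := (@rl_at d L).

Definition RL_of (f : rat -> rat -> L) (fP : real_relations f) : RL L :=
  real_of fP.

Lemma RL_ofE f (fP : real_relations f) p q : at_ (RL_of fP) p q = f p q.
Proof. exact: real_ofK. Qed.

Lemma rl_atP phi : real_relations (at_ phi).
Proof. exact: realrel_hom. Qed.

Lemma RL_ext phi psi : (forall p q, at_ phi p q = at_ psi p q) -> phi = psi.
Proof. exact: real_of_uniq. Qed.

(* The family (p, q) |-> (phi <op> psi)(p, q) defining the ring operations. *)
Definition op_family (op : rat -> rat -> rat) (phi psi : RL L) (p q : rat) : L :=
  bigjoin [set z | exists r s t u,
    (forall x y, r < x < s -> t < y < u -> p < op x y < q) /\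
    z = rl_at phi r s `&` rl_at psi t u].

Lemma rl_at_mono phi (p q r s : rat) : p <= r -> s <= q -> at_ phi r s <= at_ phi p q.
Proof. exact: realrel_mono (rl_atP phi) p q r s. Qed.

Lemma rl_at_empty phi (p q : rat) : q <= p -> at_ phi p q = \bot.
Proof.
move=> qp; apply/eqP; rewrite -lex0 (realrel_sup (rl_atP phi)).
by apply: bigjoin_le => _ [r [s [pr rs sq ->]]]; exfalso; lra.
Qed.

Lemma rl_at_itv phi p q : p < q \/ at_ phi p q = \bot.
Proof. by case: (ltP p q) => H; [left|right; exact: rl_at_empty]. Qed.

Lemma RL_le_ext phi psi :
  (forall p q r s : rat, q <= r \/ s <= p -> at_ phi p q `&` at_ psi r s = \bot) ->
  forall p q, at_ phi p q <= at_ psi p q.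
Proof.
move=> H p q; rewrite (realrel_sup (rl_atP phi)).
apply: bigjoin_le => _ [r [s [pr rs sq ->]]].
rewrite -[at_ phi r s]meetx1 (realrel_top (rl_atP psi)).
apply: meet_bigjoin_le => _ [a [b ->]].
pose a' := Order.min a p; pose b' := Order.max b q.
have ap : a' <= p by rewrite /a'; minmax.
have qb : q <= b' by rewrite /b'; minmax.
apply: (@le_trans _ _ (at_ phi r s `&` at_ psi a' b')).
  by apply: leI2 => //; apply: rl_at_mono; rewrite /a' /b'; minmax.
have R := rl_atP psi.
have -> : at_ psi a' b' = at_ psi a' r `|` at_ psi p q `|` at_ psi s b'.
  by rewrite (realrel_join R) ?(realrel_join R) //; lra.
apply: meet_join_le; first apply: meet_join_le.
- by rewrite H ?le0x //; right.
- exact: leIr.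
- by rewrite H ?le0x //; left.
Qed.

Lemma rl_at_small phi r s (e : rat) : 0%R < e ->
  at_ phi r s <= bigjoin [set z | exists a b,
    [/\ r <= a, b <= s, (b - a <= e)%R & z = at_ phi a b]].
Proof.
move=> e0; set W := bigjoin _.
have small a b : (b - a <= e)%R -> at_ phi r s `&` at_ phi a b <= W.
  move=> ab; rewrite (realrel_meet (rl_atP phi)); apply: le_bigjoin.
  by eexists; eexists; split; last reflexivity; minmax.
pose h := (e / 2)%R.
have h0 : (0 < h)%R by rewrite /h; lra.
have steps n : at_ phi r s `&` at_ phi r (r + h *+ n.+1)%R <= W.
  elim: n => [|n IH]; first by apply: small; rewrite mulr1n /h; lra.
  have hn : (0 <= h *+ n)%R by rewrite mulrn_wge0 // ltW.
  have E2 : (h *+ n.+2 = h + h + h *+ n)%R by rewrite !mulrS addrA.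
  have E1 : (h *+ n.+1 = h + h *+ n)%R by rewrite mulrS.
  have -> : at_ phi r (r + h *+ n.+2)%R =
      at_ phi r (r + h *+ n.+1)%R `|` at_ phi (r + h *+ n)%R (r + h *+ n.+2)%R.
    by rewrite (realrel_join (rl_atP phi)) // ?E1 ?E2; lra.
  apply: meet_join_le => //; apply: small; rewrite E2 /h; lra.
have [n hn] : exists n, (s <= r + h *+ n.+1)%R.
  pose n := Num.bound `|(s - r) / h|%R.
  exists n; have /ltW : (`|(s - r) / h| < n%:R)%R by exact: archi_boundP.
  rewrite ler_norml => /andP[_]; rewrite ler_pdivrMr // mulr_natl => ?.
  by rewrite mulrS; lra.
rewrite -[X in X <= _]meetxx; apply: le_trans (steps n); apply: leI2 => //.
exact: rl_at_mono.
Qed.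

Section BinaryOp.
Variable op : rat -> rat -> rat.
Hypothesis op_mon : forall x x' y y' a b : rat,
  x <= a -> a <= x' -> y <= b -> b <= y' -> exists c1 c2 : rat * rat,
  [/\ (c1.1 = x \/ c1.1 = x') /\ (c1.2 = y \/ c1.2 = y'),
      (c2.1 = x \/ c2.1 = x') /\ (c2.2 = y \/ c2.2 = y'),
      op c1.1 c1.2 <= op a b & op a b <= op c2.1 c2.2].
Hypothesis op_unif : forall M e : rat, 0%R < e -> exists2 dl : rat, 0%R < dl &
  forall a a' b b', (`|a| <= M -> `|a'| <= M -> `|b| <= M -> `|b'| <= M ->
    `|a - a'| <= dl -> `|b - b'| <= dl -> `|op a b - op a' b'| < e)%R.

Lemma op_corners x x' y y' : exists m n : rat,
  (forall a b, x <= a -> a <= x' -> y <= b -> b <= y' -> m <= op a b <= n) /\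
  (forall p q, p < op x y < q -> p < op x y' < q -> p < op x' y < q ->
     p < op x' y' < q -> p < m /\ n < q).
Proof.
exists (Order.min (Order.min (op x y) (op x y')) (Order.min (op x' y) (op x' y'))).
exists (Order.max (Order.max (op x y) (op x y')) (Order.max (op x' y) (op x' y'))).
split.
  move=> a b xa ax yb by'.
  have [[c1 c2] [[c3 c4] /= [H1 H2 H3 H4]]] := op_mon xa ax yb by'.
  rewrite !ge_min !le_max.
  case: H1 => -[] E1 [] E2; subst c1 c2; rewrite H3 ?orbT /=;
  by case: H2 => -[] E1 [] E2; subst c3 c4; rewrite H4 ?orbT.
move=> p q /andP[? ?] /andP[? ?] /andP[? ?] /andP[? ?].
by rewrite !lt_min !gt_max; split; do !(apply/andP; split).
Qed.

Lemma op_relations phi psi : real_relations (op_family op phi psi).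
Proof.
split.
- move=> p q r s; apply/eqP; rewrite eq_le; apply/andP; split.
    apply: bigjoin_meet_le => _ _ [a [b [c [e [H1 ->]]]]] [a' [b' [c' [e' [H2 ->]]]]].
    rewrite meetACA !(realrel_meet (rl_atP _)); apply: le_bigjoin.
    do 4!eexists; split; last reflexivity.
    move=> x y; rewrite !gt_max !lt_min => /andP[/andP[? ?] /andP[? ?]].
    move=> /andP[/andP[? ?] /andP[? ?]].
    have /andP[-> ->] : p < op x y < q by apply: H1; apply/andP.
    by have /andP[-> ->] : r < op x y < s by apply: H2; apply/andP.
  rewrite lexI; apply/andP; split; apply: bigjoin_le => _ [a [b [c [e [H ->]]]]];
  apply: le_bigjoin; exists a, b, c, e; split=> // x y ax cy;
  by have := H x y ax cy; rewrite gt_max lt_min => /andP[/andP[? ?] /andP[? ?]];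
  apply/andP.
- move=> p q r s pr rq qs; apply/eqP; rewrite eq_le; apply/andP; split.
    rewrite leUx; apply/andP; split; apply: bigjoin_le => _ [a [b [c [e [H ->]]]]];
    apply: le_bigjoin; exists a, b, c, e; split=> // x y ax cy;
    by have /andP[? ?] := H x y ax cy; apply/andP; split; lra.
  apply: bigjoin_le => _ [a [b [c [e [H ->]]]]]; set W := _ `|` _.
  pose M := (`|a| + `|b| + `|c| + `|e|)%R.
  have qr0 : (0 < (q - r) / 2)%R by lra.
  have [dl dl0 Hdl] := op_unif M qr0.
  apply: le_trans (leI2 (rl_at_small phi a b dl0) (rl_at_small psi c e dl0)) _.
  apply: bigjoin_meet_le => _ _ [a' [b' [aa bb ab ->]]] [c' [e' [cc ee ce ->]]].
  have [ab'|->] := rl_at_itv phi a' b'; last by rewrite meet0x le0x.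
  have [ce'|->] := rl_at_itv psi c' e'; last by rewrite meetx0 le0x.
  have bnd (x y z M1 M2 : rat) : (x < y -> y < z -> 0 <= M1 -> 0 <= M2 ->
      `|y| <= M1 + `|x| + `|z| + M2)%R.
    move=> xy yz M10 M20.
    rewrite ler_norml; apply/andP; split.
      by have := ler_norm (- x)%R; rewrite normrN; have := normr_ge0 z; lra.
      by have := ler_norm z; have := normr_ge0 x; lra.
  have bphi x : a' < x < b' -> (`|x| <= M)%R.
    move=> /andP[ax xb]; rewrite /M.
    have := bnd a x b 0%R (`|c| + `|e|)%R; rewrite add0r !addrA; apply; try lra.
    by rewrite addr_ge0.
  have bpsi x : c' < x < e' -> (`|x| <= M)%R.
    move=> /andP[ax xb]; rewrite /M.
    have := bnd c x e (`|a| + `|b|)%R 0%R; rewrite addr0; apply; try lra.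
    by rewrite addr_ge0.
  pose m := ((a' + b') / 2)%R; pose n := ((c' + e') / 2)%R.
  have mI : a' < m < b' by apply/andP; split; rewrite /m; lra.
  have nI : c' < n < e' by apply/andP; split; rewrite /n; lra.
  have near x y : a' < x < b' -> c' < y < e' ->
      (`|op x y - op m n| < (q - r) / 2)%R.
    move=> xI yI; apply: Hdl; [exact: bphi|exact: bphi|exact: bpsi|exact: bpsi|..].
      move: xI mI => /andP[? ?] /andP[? ?].
      by rewrite ler_norml; apply/andP; split; lra.
      move: yI nI => /andP[? ?] /andP[? ?].
      by rewrite ler_norml; apply/andP; split; lra.
  have inps x y : a' < x < b' -> c' < y < e' -> p < op x y < s.
    by move=> /andP[? ?] /andP[? ?]; apply: H; apply/andP; split; lra.
  have [v|v] := ltP (op m n) ((q + r) / 2)%R.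
  + apply: (@le_trans _ _ (op_family op phi psi p q)); last exact: leUl.
    apply: le_bigjoin; exists a', b', c', e'; split=> // x y xI yI.
    have /andP[-> _] /= := inps x y xI yI.
    by have := near x y xI yI; rewrite ltr_norml => /andP[? ?]; lra.
  + apply: (@le_trans _ _ (op_family op phi psi r s)); last exact: leUr.
    apply: le_bigjoin; exists a', b', c', e'; split=> // x y xI yI.
    have /andP[_ ->] /= := inps x y xI yI; rewrite andbT.
    by have := near x y xI yI; rewrite ltr_norml => /andP[? ?]; lra.
- move=> p q; apply/eqP; rewrite eq_le; apply/andP; split; last first.
    apply: bigjoin_le => _ [r [s [pr rs sq ->]]].
    apply: bigjoin_le => _ [a [b [c [e [H ->]]]]].
    apply: le_bigjoin; exists a, b, c, e; split=> // x y ax cy.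
    by have /andP[? ?] := H x y ax cy; apply/andP; split; lra.
  apply: bigjoin_le => _ [a [b [c [e [H ->]]]]].
  rewrite (realrel_sup (rl_atP phi)) (realrel_sup (rl_atP psi)).
  apply: bigjoin_meet_le => _ _ [a' [b' [aa ab bb ->]]] [c' [e' [cc ce ee ->]]].
  have [m [n [mn H2]]] := op_corners a' b' c' e'.
  have [pm nq] : p < m /\ n < q.
    by apply: H2; apply: H; apply/andP; split; lra.
  have mn' : m <= n.
    have /andP[] : m <= op a' c' <= n by apply: mn; lra.
    exact: le_trans.
  apply: (@le_bigjoint _ _ _ (op_family op phi psi ((p + m) / 2)%R ((n + q) / 2)%R)).
    exists ((p + m) / 2)%R, ((n + q) / 2)%R; split=> //; lra.
  apply: le_bigjoin; exists a', b', c', e'; split=> // x y /andP[? ?] /andP[? ?].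
  have /andP[? ?] : m <= op x y <= n by apply: mn; lra.
  by apply/andP; split; lra.
- apply/eqP; rewrite eq_le lex1 andbT -[X in X <= _]meetxx.
  rewrite {1}(realrel_top (rl_atP phi)) (realrel_top (rl_atP psi)).
  apply: bigjoin_meet_le => _ _ [a [b ->]] [c [e ->]].
  have [m [n [mn _]]] := op_corners a b c e.
  apply: (@le_bigjoint _ _ _ (op_family op phi psi (m - 1)%R (n + 1)%R)).
    by exists (m - 1)%R, (n + 1)%R.
  apply: le_bigjoin; exists a, b, c, e; split=> // x y /andP[? ?] /andP[? ?].
  have /andP[? ?] : m <= op x y <= n by apply: mn; lra.
  by apply/andP; split; lra.
Qed.

End BinaryOp.

Lemma add_relations phi psi : real_relations (op_family +%R phi psi).
Proof.
apply: op_relations => [x x' y y' a b xa ax yb by'|M e e0].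
  by exists (x, y), (x', y'); split=> /=; try lra; split; by [left|right].
exists (e / 4)%R => [|a a' b b' _ _ _ _ H1 H2]; first lra.
have -> : (a + b - (a' + b') = (a - a') + (b - b'))%R by ring.
by apply: le_lt_trans (ler_normD _ _) _; lra.
Qed.

Lemma mul_relations phi psi : real_relations (op_family *%R phi psi).
Proof.
apply: op_relations => [x x' y y' a b xa ax yb by'|M e e0].
  have H1 (u v w z : rat) : v <= w -> w <= z -> exists c1 c2, [/\
    c1 = v \/ c1 = z, c2 = v \/ c2 = z, (u * c1 <= u * w)%R & (u * w <= u * c2)%R].
    move=> vw wz; have [u0|u0] := leP 0%R u.
      exists v, z; split; [by left|by right|exact: ler_wpM2l..].
    by exists z, v; split; [by right|by left|apply: ler_wnM2l => //; exact: ltW..].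
  have [c1 [c2 [E1 E2 L1 L2]]] := H1 a y b y' yb by'.
  have [d1 [_ [F1 _ K1 _]]] := H1 c1 x a x' xa ax.
  have [_ [d2 [_ F2 _ K2]]] := H1 c2 x a x' xa ax.
  exists (d1, c1), (d2, c2); split=> //=.
    by apply: le_trans L1; rewrite mulrC [X in _ <= X]mulrC.
  by apply: le_trans L2 _; rewrite mulrC [X in _ <= X]mulrC.
pose N := (`|M| + 1)%R.
have N0 : (0 < N)%R by rewrite /N; have := normr_ge0 M; lra.
have MN : (M <= N)%R by rewrite /N; have := ler_norm M; lra.
exists (e / (4 * N))%R => [|a a' b b' Ha Ha' Hb Hb' H1 H2].
  by apply: divr_gt0; lra.
have -> : (a * b - a' * b' = (a - a') * b + a' * (b - b'))%R by ring.
apply: le_lt_trans (ler_normD _ _) _; rewrite !normrM.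
have B1 : (`|a - a'| * `|b| <= e / (4 * N) * N)%R.
  by apply: ler_pM => //; lra.
have B2 : (`|a'| * `|b - b'| <= N * (e / (4 * N)))%R.
  by apply: ler_pM => //; lra.
have E : (e / (4 * N) * N = e / 4)%R by field; lra.
by rewrite (mulrC N) E in B2; rewrite E in B1; lra.
Qed.

Definition const_family (c p q : rat) : L := if p < c < q then \top else \bot.

Lemma const_relations c : real_relations (const_family c).
Proof.
rewrite /const_family; split.
- move=> p q r s; rewrite gt_max lt_min.
  by case: (p < c); case: (c < q); case: (r < c); case: (c < s);
     rewrite /= ?meetxx ?meet1x ?meetx1 ?meet0x ?meetx0.
- move=> p q r s pr rq qs.
  case: (ltP p c) => pc; case: (ltP c q) => cq;
  case: (ltP r c) => rc; case: (ltP c s) => cs /=;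
  rewrite ?joinxx ?join1x ?joinx1 ?join0x ?joinx0 //; exfalso; lra.
- move=> p q; apply/eqP; rewrite eq_le; apply/andP; split; last first.
    apply: bigjoin_le => _ [r [s [pr rs sq ->]]].
    case: ifP => // /andP[rc cs].
    by rewrite ifT //; apply/andP; split; lra.
  case: ifP => // /andP[pc cq]; apply: le_bigjoin.
  exists ((p + c) / 2)%R, ((c + q) / 2)%R; split; [lra|lra|lra|].
  by rewrite ifT //; apply/andP; split; lra.
- apply/eqP; rewrite eq_le lex1 andbT; apply: le_bigjoin.
  exists (c - 1)%R, (c + 1)%R.
  by rewrite ifT //; apply/andP; split; lra.
Qed.

Lemma opp_relations phi : real_relations (fun p q => at_ phi (- q)%R (- p)%R).
Proof.
have [R1 R2 R3 R4] := rl_atP phi; split.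
- by move=> p q r s; rewrite R1; congr at_; minmax.
- by move=> p q r s pr rq qs; rewrite joinC; apply: R2; lra.
- move=> p q; rewrite R3; congr bigjoin; apply/seteqP; split=> x.
    move=> [r [s [pr rs sq ->]]]; exists (- s)%R, (- r)%R.
    by rewrite !opprK; split=> //; lra.
  move=> [r [s [pr rs sq ->]]]; exists (- s)%R, (- r)%R.
  by split=> //; lra.
- rewrite R4; congr bigjoin; apply/seteqP; split=> x [r [s ->]];
  by exists (- s)%R, (- r)%R; rewrite ?opprK.
Qed.

Definition RL_add phi psi : RL L := RL_of (add_relations phi psi).
Definition RL_mul phi psi : RL L := RL_of (mul_relations phi psi).
Definition RL_opp phi : RL L := RL_of (opp_relations phi).
Definition RL_const c : RL L := RL_of (const_relations c).

(* Ring identities are checked on rational points: two elements of [RL L] that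
   are covered, in the sense below, by the same pointwise expression in given
   elements [phi], [psi], [chi] are equal. *)
Section Identities.
Variables phi psi chi : RL L.

Definition expressed (F : rat -> rat -> rat -> rat) (h : RL L) : Prop :=
  forall p q, at_ h p q <= bigjoin [set z | exists a a' b b' c c',
    (forall x y w, a < x < a' -> b < y < b' -> c < w < c' -> p < F x y w < q) /\
    z = at_ phi a a' `&` at_ psi b b' `&` at_ chi c c'].

Lemma expressed_le F h h' : expressed F h -> expressed F h' ->
  forall p q, at_ h p q <= at_ h' p q.
Proof.
move=> Fh Fh'; apply: RL_le_ext => p q r s pqrs.
apply/eqP; rewrite -lex0; apply: le_trans (leI2 (Fh p q) (Fh' r s)) _.
apply: bigjoin_meet_le => _ _ [a [a' [b [b' [c [c' [H ->]]]]]]]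
  [u [u' [v [v' [w [w' [K ->]]]]]]].
rewrite meetACA (meetACA (at_ phi a a')) !(realrel_meet (rl_atP _)).
have [I1|->] := rl_at_itv phi (Order.max a u) (Order.min a' u'); last by rewrite !meet0x.
have [I2|->] := rl_at_itv psi (Order.max b v) (Order.min b' v');
  last by rewrite meetx0 meet0x.
have [I3|->] := rl_at_itv chi (Order.max c w) (Order.min c' w');
  last by rewrite meetx0.
exfalso.
have mid (i j k l : rat) : Order.max i j < Order.min k l -> exists x, i < x < k /\ j < x < l.
  rewrite gt_max !lt_min => /andP[/andP[? ?] /andP[? ?]].
  exists ((Order.max i j + Order.min k l) / 2)%R.
  by split; apply/andP; split; minmax.
have [x [x1 x2]] := mid _ _ _ _ I1.
have [y [y1 y2]] := mid _ _ _ _ I2.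
have [z [z1 z2]] := mid _ _ _ _ I3.
have /andP[? ?] := H _ _ _ x1 y1 z1.
have /andP[? ?] := K _ _ _ x2 y2 z2.
by case: pqrs => ?; lra.
Qed.

Lemma expressed_uniq F h h' : expressed F h -> expressed F h' -> h = h'.
Proof.
move=> Fh Fh'; apply: RL_ext => p q; apply/eqP; rewrite eq_le.
by rewrite (expressed_le Fh Fh') (expressed_le Fh' Fh).
Qed.

Lemma expressed_ext F G h :
  (forall x y z, F x y z = G x y z) -> expressed F h -> expressed G h.
Proof.
move=> FG; suff -> : F = G by [].
by apply/funext => x; apply/funext => y; apply/funext => z.
Qed.

Lemma le_cover y W : (forall a a' b b' c c',
    at_ phi a a' `&` at_ psi b b' `&` at_ chi c c' `&` y <= W) -> y <= W.
Proof.
move=> H; rewrite -[y]meet1x (realrel_top (rl_atP chi)).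
apply: bigjoin_meetl_le => _ [c [c' ->]].
rewrite -[X in X <= _]meet1x (realrel_top (rl_atP psi)).
apply: bigjoin_meetl_le => _ [b [b' ->]].
rewrite -[X in X <= _]meet1x (realrel_top (rl_atP phi)).
apply: bigjoin_meetl_le => _ [a [a' ->]].
by rewrite !meetA.
Qed.

Lemma expressed1 : expressed (fun x _ _ => x) phi.
Proof.
move=> p q; apply: le_cover => a a' b b' c c'.
rewrite meetC !meetA (realrel_meet (rl_atP phi)); apply: le_bigjoin.
do 6!eexists; split; last reflexivity.
by move=> x y z; rewrite gt_max lt_min => /andP[/andP[-> _] /andP[-> _]].
Qed.

Lemma expressed2 : expressed (fun _ y _ => y) psi.
Proof.
move=> p q; apply: le_cover => a a' b b' c c'.
rewrite meetAC -(meetA (at_ phi a a')) (realrel_meet (rl_atP psi)).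
apply: le_bigjoin; do 6!eexists; split; last reflexivity.
by move=> x y z _; rewrite gt_max lt_min => /andP[/andP[_ ->] /andP[_ ->]].
Qed.

Lemma expressed3 : expressed (fun _ _ z => z) chi.
Proof.
move=> p q; apply: le_cover => a a' b b' c c'.
rewrite -meetA (realrel_meet (rl_atP chi)).
apply: le_bigjoin; do 6!eexists; split; last reflexivity.
by move=> x y z _ _; rewrite gt_max lt_min => /andP[/andP[_ ->] /andP[_ ->]].
Qed.

Lemma expressed_op op F G h1 h2 h :
  (forall p q, at_ h p q = op_family op h1 h2 p q) ->
  expressed F h1 -> expressed G h2 ->
  expressed (fun x y z => op (F x y z) (G x y z)) h.
Proof.
move=> hE Fh Gh p q; rewrite hE; apply: bigjoin_le => _ [r [s [t [u [H ->]]]]].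
apply: le_trans (leI2 (Fh r s) (Gh t u)) _.
apply: bigjoin_meet_le => _ _ [a [a' [b [b' [c [c' [H1 ->]]]]]]]
  [i [i' [j [j' [k [k' [H2 ->]]]]]]].
rewrite meetACA (meetACA (at_ phi a a')) !(realrel_meet (rl_atP _)).
apply: le_bigjoin; do 6!eexists; split; last reflexivity.
move=> x y z; rewrite !gt_max !lt_min.
move=> /andP[/andP[? ?] /andP[? ?]] /andP[/andP[? ?] /andP[? ?]].
move=> /andP[/andP[? ?] /andP[? ?]].
by apply: H; [apply: H1|apply: H2]; apply/andP.
Qed.

Lemma expressed_add F G h1 h2 : expressed F h1 -> expressed G h2 ->
  expressed (fun x y z => F x y z + G x y z)%R (RL_add h1 h2).
Proof. by apply: expressed_op => p q; exact: RL_ofE. Qed.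

Lemma expressed_mul F G h1 h2 : expressed F h1 -> expressed G h2 ->
  expressed (fun x y z => F x y z * G x y z)%R (RL_mul h1 h2).
Proof. by apply: expressed_op => p q; exact: RL_ofE. Qed.

Lemma expressed_opp F h : expressed F h ->
  expressed (fun x y z => - F x y z)%R (RL_opp h).
Proof.
move=> Fh p q; rewrite RL_ofE; apply: le_trans (Fh _ _) _.
apply: bigjoin_le => _ [a [a' [b [b' [c [c' [H ->]]]]]]].
apply: le_bigjoin; exists a, a', b, b', c, c'; split=> // x y z xa yb zc.
by have /andP[? ?] := H x y z xa yb zc; apply/andP; split; lra.
Qed.

Lemma expressed_const k : expressed (fun _ _ _ => k) (RL_const k).
Proof.
move=> p q; rewrite RL_ofE /const_family; case: ifP => [pkq|_]; last exact: le0x.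
apply: le_cover => a a' b b' c c'; rewrite meetx1.
by apply: le_bigjoin; exists a, a', b, b', c, c'.
Qed.

End Identities.

Ltac RL_identity phi psi chi F :=
  apply: (@expressed_uniq phi psi chi F);
  [|refine (expressed_ext (F := _) _ _); last first];
  repeat first [exact: expressed1 | exact: expressed2 | exact: expressed3
    | apply: expressed_const | apply: expressed_add | apply: expressed_mul
    | apply: expressed_opp].

Fact RL_addA : associative RL_add.
Proof.
move=> phi psi chi.
RL_identity phi psi chi (fun x y z : rat => x + (y + z))%R.
by move=> x y z /=; rewrite addrA.
Qed.

Fact RL_addC : commutative RL_add.
Proof.
move=> phi psi.
RL_identity phi psi phi (fun x y z : rat => x + y)%R.
by move=> x y z /=; rewrite addrC.
Qed.

Fact RL_add0 : left_id (RL_const 0%R) RL_add.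
Proof.
move=> phi.
RL_identity phi phi phi (fun x y z : rat => 0 + x)%R.
by move=> x y z /=; rewrite add0r.
Qed.

Fact RL_addN : left_inverse (RL_const 0%R) RL_opp RL_add.
Proof.
move=> phi.
RL_identity phi phi phi (fun x y z : rat => - x + x)%R.
by move=> x y z /=; rewrite addNr.
Qed.

Fact RL_mulA : associative RL_mul.
Proof.
move=> phi psi chi.
RL_identity phi psi chi (fun x y z : rat => x * (y * z))%R.
by move=> x y z /=; rewrite mulrA.
Qed.

Fact RL_mulC : commutative RL_mul.
Proof.
move=> phi psi.
RL_identity phi psi phi (fun x y z : rat => x * y)%R.
by move=> x y z /=; rewrite mulrC.
Qed.

Fact RL_mul1 : left_id (RL_const 1%R) RL_mul.
Proof.
move=> phi.
RL_identity phi phi phi (fun x y z : rat => 1 * x)%R.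
by move=> x y z /=; rewrite mul1r.
Qed.

Fact RL_mulDl : left_distributive RL_mul RL_add.
Proof.
move=> phi psi chi.
RL_identity phi psi chi (fun x y z : rat => (x + y) * z)%R.
by move=> x y z /=; rewrite mulrDl.
Qed.

End RLTheory.

HB.instance Definition _ d (L : frameType d) := GRing.isZmodule.Build (RL L)
  (@RL_addA d L) (@RL_addC d L) (@RL_add0 d L) (@RL_addN d L).
HB.instance Definition _ d (L : frameType d) :=
  GRing.Zmodule_isComPzRing.Build (RL L)
  (@RL_mulA d L) (@RL_mulC d L) (@RL_mul1 d L) (@RL_mulDl d L).

Section RLOperations.
Context {d : Order.disp_t} {L : frameType d}.
Implicit Types phi psi : RL L.

Lemma rl_at_add phi psi p q :
  rl_at (phi + psi)%R p q = op_family +%R phi psi p q.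
Proof. exact: RL_ofE. Qed.

Lemma rl_at_mul phi psi p q :
  rl_at (phi * psi)%R p q = op_family *%R phi psi p q.
Proof. exact: RL_ofE. Qed.

Definition coz phi : L :=
  bigjoin [set x | exists p q, x = rl_at phi p 0%R `|` rl_at phi 0%R q].

End RLOperations.

Definition Coz d (L : frameType d) : set L := range (@coz d L).
Arguments Coz {d} L.

Definition PF_frame d (L : frameType d) : Prop :=
  forall a b : L, Coz L a -> Coz L b -> a `&` b = \bot ->
    complemented a \/ complemented b.

Section Ideals.
Context {d : Order.disp_t} {L : frameType d}.
Implicit Types (I J : set (RL L)) (phi alpha : RL L).
Local Open Scope ring_scope.

(* The whole ring counts as an ideal. *)
Definition ideal I : Prop :=
  [/\ I 0, (forall x y, I x -> I y -> I (x + y)) & (forall a x, I x -> I (a * x))].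

Definition ideal_sum I J : set (RL L) :=
  [set z | exists x y, [/\ I x, J y & z = x + y]].

Definition z_ideal I : Prop :=
  ideal I /\ forall alpha phi, I phi -> coz alpha = coz phi -> I alpha.

Definition regular phi : Prop := forall psi : RL L, phi * psi = 0 -> psi = 0.

Definition r_ideal I : Prop :=
  ideal I /\ forall alpha phi, regular phi -> I (alpha * phi) -> I alpha.

Definition zr_ideal I : Prop := z_ideal I /\ r_ideal I.

End Ideals.

(* Main.v *)
Require Import Defs.
From mathcomp Require Import all_boot all_order all_algebra.
From mathcomp Require Import boolp classical_sets.
From mathcomp Require Import ring lra.

(** For [f] in [RL L] think of [coz f] as the open set where [f] does not vanish.
    An ideal [I] is a z_r-ideal exactly when [f] in [I], [phi] regular and
    [coz (alpha * phi) <= coz f] force [alpha] in [I] ([zr_idealP]).  If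
    [coz f] is complemented then [f] is von Neumann regular
    ([coz_complementedP]), so that this implication holds in every ideal.

    The consequences of the P_F condition all rest on one comparison of two
    elements ([PF_dominated]).  The elements [(f^2 - g^2)^+] and
    [(g^2 - f^2)^+] have disjoint cozero elements, so one of these is
    complemented; if it is the first, with idempotent [e], then [f] divides
    [e], while [f^2 <= g^2] off [e] makes [(1 - e) * f^4] a multiple of [g].
    Thus, off a complemented part where it is invertible, [f] is as good as
    divisible by [g], or the other way round.
    - Let [I `&` J] be a z_r-ideal and compare [f] in [I] with [g] in [J].  In
      the first case, if [alpha] should lie in [I] because of [f], then
      [e * alpha] does because [e] is in [I], and [(1 - e) * alpha] lies in
      [I `&` J] because [(1 - e) * f^4] does ([PF_intersection]).
    - For a sum [i + j] in the sum of two z_r-ideals, [e] lies in the ideal of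
      [i], and off [e] the cozero of [i + j] is below that of [j] ([PF_sum]).
    - If [I + J] is a z_r-ideal it contains ninth roots of its elements.
      Suppose that [f] in [I] and [g] in [J] show that neither is a z_r-ideal.
      Splitting the roots of the two missing elements and comparing the
      summands gives an [e] in one ideal such that [1 - e] carries the missing
      element of the other into that ideal.  Then disjoint pieces of [coz f]
      and [coz g] are both non-complemented, against P_F ([PF_summand]).

    Conversely, let [coz f] and [coz g] be disjoint.  A z_r-ideal containing
    [f] contains its cube root, and if that root is a multiple of [f] then
    [coz f] is complemented ([complemented_of_cube_root]).  This applies to the
    principal ideals of [f] and [g], whose intersection is [0]
    ([intersection_PF]).  For sums, let [Z f] be the z_r-ideal generated by
    [f]; the ideals [(f) + Z g] and [Z f + (g)] add up to [Z f + Z g], a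
    z_r-ideal by the assumption on sums.  For the condition on
    summands to apply this sum has to be proper, which is arranged by first
    cutting away the part of [coz f] where [f] is large ([shrink_coz], [sum_PF]).

    Four kinds of elements of [RL L] have to be constructed: maxima, a
    substitute for quotients, cube roots, and inverses on a complemented cozero
    element. *)

Set Implicit Arguments.
Unset Strict Implicit.
Unset Printing Implicit Defensive.

Import Order.TTheory GRing.Theory Num.Theory.

(** * Cozero elements *)

Section CozeroElements.
Context {d : Order.disp_t} {L : frameType d}.
Implicit Types (v w : L) (phi psi h : RL L) (p q r s t u : rat).
Local Open Scope order_scope.
Local Notation at_ := (@rl_at d L).

Lemma complementedP v : complemented v <-> exists w, v `&` w = \bot /\ v `|` w = \top.
Proof.
split=> [vc|[w [vw0 vw1]]].
  exists (pseudocompl v); split=> //; apply/eqP; rewrite -lex0.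
  by apply: meet_bigjoin_le => z; rewrite /= meetC => ->.
apply/eqP; rewrite -le1x -vw1; apply: leU2 => //.
by apply: le_bigjoin; rewrite /= meetC.
Qed.

Lemma rl_at_meet0 phi p q r s : q <= r \/ s <= p -> at_ phi p q `&` at_ phi r s = \bot.
Proof.
move=> H; rewrite (realrel_meet (rl_atP phi)); apply: rl_at_empty.
by rewrite ge_min !le_max; case: H => ->; rewrite ?orbT.
Qed.

(** The hypothesis says that the two functions nowhere take different values.
    Since it is symmetric, the one-sided criterion [RL_le_ext] applies twice. *)
Lemma RL_disjoint_ext phi psi :
  (forall p q r s, q <= r \/ s <= p -> at_ phi p q `&` at_ psi r s = \bot) ->
  phi = psi.
Proof.
move=> H; apply: RL_ext => p q; apply/eqP; rewrite eq_le !RL_le_ext //.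
by move=> a b a' b' ab; rewrite meetC H //; case: ab; [right|left].
Qed.

Lemma le_coz phi r s : s <= 0%R \/ 0%R <= r -> at_ phi r s <= coz phi.
Proof.
case=> [s0|r0]; apply: (@le_bigjoint _ _ _ (at_ phi r 0%R `|` at_ phi 0%R s)).
- by exists r, s.
- by apply: le_trans (leUl _ _); exact: rl_at_mono.
- by exists r, s.
- by apply: le_trans (leUr _ _); exact: rl_at_mono.
Qed.

Lemma coz_leP phi v :
  (forall r s, s <= 0%R \/ 0%R <= r -> at_ phi r s <= v) -> coz phi <= v.
Proof.
by move=> H; apply: bigjoin_le => _ [r [s ->]]; rewrite leUx !H //; [right|left].
Qed.

(** Intervals bounded away from zero suffice, every interval being the join of
    those strictly inside it. *)
Lemma coz_le_strict phi v :
  (forall r s, r < s -> s < 0%R \/ 0%R < r -> at_ phi r s <= v) -> coz phi <= v.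
Proof.
move=> H; apply: coz_leP => r s rs0; rewrite (realrel_sup (rl_atP phi)).
apply: bigjoin_le => _ [r' [s' [rr rs ss ->]]]; apply: H => //.
by case: rs0 => ?; [left|right]; lra.
Qed.

Lemma coz_op_le (op : rat -> rat -> rat) phi psi h :
  (forall p q, at_ h p q = op_family op phi psi p q) -> op 0%R 0%R = 0%R ->
  coz h <= coz phi `|` coz psi.
Proof.
move=> hE op0; apply: coz_leP => p q pq0; rewrite hE.
apply: bigjoin_le => _ [r [s [t [u [H ->]]]]].
have [s0|s0] := leP s 0%R.
  by apply: leIxl; apply: le_trans (leUl _ _); apply: le_coz; left.
have [r0|r0] := leP 0%R r.
  by apply: leIxl; apply: le_trans (leUl _ _); apply: le_coz; right.
have [u0|u0] := leP u 0%R.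
  by apply: leIxr; apply: le_trans (leUr _ _); apply: le_coz; left.
have [t0|t0] := leP 0%R t.
  by apply: leIxr; apply: le_trans (leUr _ _); apply: le_coz; right.
exfalso; have := H 0%R 0%R; rewrite r0 s0 t0 u0 op0 => /(_ isT isT)/andP[].
by case: pq0 => ? ? ?; lra.
Qed.

Lemma coz_add phi psi : coz (phi + psi)%R <= coz phi `|` coz psi.
Proof. by apply: coz_op_le (rl_at_add phi psi) _; rewrite addr0. Qed.

Lemma coz_mul_le phi psi : coz (phi * psi)%R <= coz phi.
Proof.
apply: coz_leP => p q pq0; rewrite rl_at_mul.
apply: bigjoin_le => _ [r [s [t [u [H ->]]]]].
have [s0|s0] := leP s 0%R; first by apply: leIxl; apply: le_coz; left.
have [r0|r0] := leP 0%R r; first by apply: leIxl; apply: le_coz; right.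
have [tu|->] := rl_at_itv psi t u; last by rewrite meetx0 le0x.
exfalso; have := H 0%R ((t + u) / 2)%R; rewrite r0 s0 mul0r => /(_ isT).
have -> : (t < (t + u) / 2 < u)%R by apply/andP; split; lra.
by move=> /(_ isT)/andP[]; case: pq0 => ? ? ?; lra.
Qed.

Lemma coz_mul phi psi : coz (phi * psi)%R = coz phi `&` coz psi.
Proof.
apply/eqP; rewrite eq_le lexI coz_mul_le mulrC coz_mul_le /=.
rewrite /coz; apply: bigjoin_meetl_le => _ [p [q ->]].
apply: meet_bigjoin_le => _ [p' [q' ->]].
rewrite -/(coz _).
have box r s t u (a b : rat) : b <= 0%R \/ 0%R <= a ->
    (forall x y, r < x < s -> t < y < u -> a < y * x < b)%R ->
    at_ phi r s `&` at_ psi t u <= coz (psi * phi)%R.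
  move=> ab H; apply: le_trans (le_coz _ ab); rewrite rl_at_mul meetC.
  apply: le_bigjoin; exists t, u, r, s; split=> // x y ? ?; exact: H.
apply: meet_join_le; rewrite meetC; apply: meet_join_le; rewrite meetC.
- apply: (box _ _ _ _ 0%R (p * p' + 1)%R); first by right.
  by move=> x y /andP[? ?] /andP[? ?]; apply/andP; split; nra.
- apply: (box _ _ _ _ (q * p' - 1)%R 0%R); first by left.
  by move=> x y /andP[? ?] /andP[? ?]; apply/andP; split; nra.
- apply: (box _ _ _ _ (p * q' - 1)%R 0%R); first by left.
  by move=> x y /andP[? ?] /andP[? ?]; apply/andP; split; nra.
- apply: (box _ _ _ _ 0%R (q * q' + 1)%R); first by right.
  by move=> x y /andP[? ?] /andP[? ?]; apply/andP; split; nra.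
Qed.

Lemma rl_at_const c p q : at_ (RL_const c) p q = if p < c < q then \top else \bot.
Proof. exact: RL_ofE. Qed.

Lemma coz_const c : c != 0%R -> coz (RL_const c : RL L) = \top.
Proof.
move=> c0; apply/eqP; rewrite -le1x.
have [cn|cp] : c < 0%R \/ 0%R < c by apply/orP; rewrite -neq_lt.
- apply: le_trans (le_coz (r := (c - 1)%R) (s := 0%R) _ _); last by left.
  by rewrite rl_at_const ifT //; apply/andP; split; lra.
- apply: le_trans (le_coz (r := 0%R) (s := (c + 1)%R) _ _); last by right.
  by rewrite rl_at_const ifT //; apply/andP; split; lra.
Qed.

Lemma coz1 : coz (1%R : RL L) = \top.
Proof. exact: coz_const. Qed.

Lemma coz_eq0 phi : coz phi = \bot <-> phi = 0%R.
Proof.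
split=> [phi0|->].
  apply: RL_disjoint_ext => p q r s H.
  rewrite (rl_at_const 0%R); case: ifP => [/andP[r0 s0]|]; last by rewrite meetx0.
  rewrite meetx1; apply/eqP; rewrite -lex0 -phi0; apply: le_coz.
  by case: H => ?; [left|right]; lra.
apply/eqP; rewrite -lex0; apply: coz_leP => r s rs0.
rewrite (rl_at_const 0%R) ifF //; apply/negP => /andP[? ?].
by case: rs0 => ?; lra.
Qed.

Lemma coz0 : coz (0%R : RL L) = \bot. Proof. exact/coz_eq0. Qed.

Lemma coz_exp phi n : coz (phi ^+ n.+1)%R = coz phi.
Proof. by elim: n => [|n IH]; rewrite ?expr1 // exprS coz_mul IH meetxx. Qed.

Lemma sqr_eq0 phi : (phi * phi = 0)%R -> phi = 0%R.
Proof. by move=> /coz_eq0; rewrite coz_mul meetxx => /coz_eq0. Qed.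

End CozeroElements.

(** * Maxima and quotients *)

Section MaxAndQuotient.
Implicit Types (x y a b e : rat).
Local Open Scope ring_scope.

(** For [0 < x <= y] this is [x^2 / y]: a quotient that stays continuous at
    zeros of [y], whence [y] divides [x^2] for functions [0 <= x <= y].  Taking
    the maximum with [x] in the denominator makes it a total Lipschitz
    function, increasing in [x] and decreasing in [y], so that it acts on
    [RL L]. *)
Definition sqr_quot x y : rat := if x <= 0 then 0 else x ^+ 2 / Order.max x y.

Lemma sqr_quotM x y : sqr_quot x y * Order.max x y = Order.max x 0 ^+ 2.
Proof.
rewrite /sqr_quot; case: (leP x 0) => x0; first by rewrite mul0r expr0n.
by rewrite divfK // gt_eqF // lt_max x0.
Qed.

Lemma sqr_quot_bounds x y : 0 <= sqr_quot x y <= Order.max x 0.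
Proof.
rewrite /sqr_quot; case: (leP x 0) => x0; first by rewrite lexx.
have m0 : 0 < Order.max x y by rewrite lt_max x0.
apply/andP; split; first by rewrite divr_ge0 ?sqr_ge0 ?ltW.
rewrite ler_pdivrMr // expr2 ler_pM2l //.
by rewrite le_max lexx.
Qed.

Lemma sqr_quot_mono x y a b : x <= a -> b <= y -> sqr_quot x y <= sqr_quot a b.
Proof.
move=> xa byy; have /andP[Q0 _] := sqr_quot_bounds a b.
rewrite {1}/sqr_quot; case: (leP x 0) => // x0; have a0 : 0 < a by lra.
rewrite /sqr_quot (lt_geF a0).
have m0 : 0 < Order.max x y by rewrite lt_max x0.
have n0 : 0 < Order.max a b by rewrite lt_max a0.
rewrite ler_pdivrMr // mulrAC ler_pdivlMr //.
have mx : x <= Order.max x y by rewrite le_max lexx.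
have my : y <= Order.max x y by rewrite le_max lexx orbT.
move: mx my m0; set m := Order.max x y => mx my m0.
have xxaa : x ^+ 2 <= a ^+ 2 by rewrite lerXn2r // nnegrE ltW.
case: (leP a b) => [ab|ba]; first by apply: ler_pM => //; rewrite ?sqr_ge0; lra.
have : x * (x * a) <= m * (a * a).
  by apply: ler_pM => //; rewrite ?ler_pM2r // ?mulr_ge0 // ltW.
by rewrite !expr2; lra.
Qed.

(** By monotonicity, moving both arguments in the direction that increases the
    value is the worst case of the Lipschitz estimate. *)
Lemma sqr_quot_shift x y a b : 0 <= a -> 0 <= b ->
  sqr_quot (x + a) (y - b) <= sqr_quot x y + 2 * a + b.
Proof.
move=> a0 b0; have [x0|x0] := leP x 0.
  have /andP[Q0 _] := sqr_quot_bounds x y.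
  have /andP[_] := sqr_quot_bounds (x + a) (y - b).
  by case: (leP (x + a) 0) => ? ?; lra.
have /andP[Q0] := sqr_quot_bounds x y; rewrite (max_l (ltW x0)) => Qx.
have := sqr_quotM x y; rewrite (max_l (ltW x0)) => Qm.
have xa0 : 0 < x + a by lra.
have n0 : 0 < Order.max (x + a) (y - b) by rewrite lt_max xa0.
rewrite {1}/sqr_quot (lt_geF xa0) ler_pdivrMr //.
have n1 : x + a <= Order.max (x + a) (y - b) by rewrite le_max lexx.
have n2 : Order.max x y - b <= Order.max (x + a) (y - b).
  case: (leP x y) => ?; first by rewrite le_max lexx orbT.
  by apply: le_trans n1; lra.
move: n0 n1 n2 Qm; set n := Order.max (x + a) _; set m := Order.max x y.
move: Q0 Qx; set q := sqr_quot x y => Q0 Qx n0 n1 n2 Qm.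
have P1 := ler_wpM2l a0 n1.
have P2 := ler_wpM2l Q0 n2.
have P3 : 0 <= b * (n - q) by apply: mulr_ge0; lra.
have P4 : 0 <= a * a by exact: mulr_ge0.
rewrite mulrBr in P2 P3; move: P1 P2 P3 P4 Qm; rewrite !mulrDl !mulrDr !expr2.
by rewrite !mulrDl !mulrDr; lra.
Qed.

Lemma sqr_quot_lipschitz x y a b :
  `|sqr_quot x y - sqr_quot a b| <= 2 * `|x - a| + `|y - b|.
Proof.
have half x' y' a' b' : sqr_quot x' y' <= sqr_quot a' b' + 2 * `|x' - a'| + `|y' - b'|.
  apply: le_trans (sqr_quot_shift a' b' (normr_ge0 (x' - a')) (normr_ge0 (y' - b'))).
  apply: sqr_quot_mono; first by have := ler_norm (x' - a'); lra.
  by have := ler_norm (b' - y'); rewrite distrC; lra.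
rewrite ler_norml; apply/andP; split; last by have := half x y a b; lra.
by have := half a b x y; rewrite (distrC a) (distrC b); lra.
Qed.

Context {d : Order.disp_t} {L : frameType d}.
Implicit Types phi psi : RL L.

Lemma sqr_quot_relations phi psi : real_relations (op_family sqr_quot phi psi).
Proof.
apply: op_relations => [x x' y y' a b xa ax yb by'|M e e0].
  exists (x, y'), (x', y); split=> /=; try exact: sqr_quot_mono.
    by split; [left|right].
  by split; [right|left].
exists (e / 4) => [|a a' b b' _ _ _ _ H1 H2]; first lra.
by apply: le_lt_trans (sqr_quot_lipschitz _ _ _ _) _; lra.
Qed.

Lemma max_relations phi psi : real_relations (op_family Order.max phi psi).
Proof.
apply: op_relations => [x x' y y' a b xa ax yb by'|M e e0].
  exists (x, y), (x', y'); split=> /=; try by split; by [left|right].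
    by rewrite ge_max !le_max xa yb orbT.
  by rewrite ge_max !le_max ax by' orbT.
exists (e / 2) => [|a a' b b' _ _ _ _]; first lra.
rewrite !ler_norml !ltr_norml => /andP[? ?] /andP[? ?].
by apply/andP; split; case: (leP a b) => ?; case: (leP a' b') => ?; lra.
Qed.

Definition RL_sqr_quot phi psi : RL L := RL_of (sqr_quot_relations phi psi).
Definition RL_max phi psi : RL L := RL_of (max_relations phi psi).

Lemma expressed_sqr_quot (f1 f2 f3 : RL L) F G h1 h2 :
  expressed f1 f2 f3 F h1 -> expressed f1 f2 f3 G h2 ->
  expressed f1 f2 f3 (fun x y z => sqr_quot (F x y z) (G x y z)) (RL_sqr_quot h1 h2).
Proof. by apply: expressed_op => p q; exact: RL_ofE. Qed.

Lemma expressed_max (f1 f2 f3 : RL L) F G h1 h2 :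
  expressed f1 f2 f3 F h1 -> expressed f1 f2 f3 G h2 ->
  expressed f1 f2 f3 (fun x y z => Order.max (F x y z) (G x y z)) (RL_max h1 h2).
Proof. by apply: expressed_op => p q; exact: RL_ofE. Qed.

End MaxAndQuotient.

(* Follows the shape of [h] in a goal [expressed phi psi _ ?F h], which
   determines the rational function [?F]. *)
Ltac RL_express phi psi :=
  lazymatch goal with
  | |- expressed _ _ _ _ phi => exact: expressed1
  | |- expressed _ _ _ _ psi => exact: expressed2
  | |- expressed _ _ _ _ (RL_sqr_quot _ _) =>
      apply: expressed_sqr_quot; RL_express phi psi
  | |- expressed _ _ _ _ (RL_max _ _) =>
      apply: expressed_max; RL_express phi psi
  | |- expressed _ _ _ _ (RL_const ?c) => exact: (expressed_const _ _ _ c)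
  | |- expressed _ _ _ _ (_ + _)%R =>
      refine (expressed_add _ _); RL_express phi psi
  | |- expressed _ _ _ _ (_ * _)%R =>
      refine (expressed_mul _ _); RL_express phi psi
  | |- expressed _ _ _ _ (- _)%R =>
      refine (expressed_opp _); RL_express phi psi
  | |- expressed _ _ _ _ 0%R => exact: (expressed_const _ _ _ 0%R)
  | |- expressed _ _ _ _ 1%R => exact: (expressed_const _ _ _ 1%R)
  end.

(* By [expressed_uniq] an identity between expressions in [phi] and [psi] holds
   in [RL L] once it holds for all rational values of [phi] and [psi]. *)
Ltac RL_pointwise phi psi :=
  apply: (@expressed_uniq _ _ phi psi psi);
  [|refine (expressed_ext (F := _) _ _); last first];
  [RL_express phi psi|RL_express phi psi|move=> x y _ /=].

Section Identities.
Context {d : Order.disp_t} {L : frameType d}.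
Implicit Types phi psi : RL L.
Local Open Scope ring_scope.

Lemma RL_sqr_quotM phi psi :
  RL_sqr_quot phi psi * RL_max phi psi = RL_max phi 0 * RL_max phi 0.
Proof. by RL_pointwise phi psi; rewrite sqr_quotM. Qed.

Lemma RL_excess_mul phi psi :
  RL_max (phi - psi) 0 * RL_max (psi - phi) 0 = 0.
Proof.
RL_pointwise phi psi.
by case: (leP (y - x) 0) => ?; case: (leP (x - y) 0) => ?;
  rewrite ?mulr0 ?mul0r //; exfalso; lra.
Qed.

Lemma RL_excess phi psi : RL_max phi psi = psi + RL_max (phi - psi) 0.
Proof.
RL_pointwise phi psi.
by case: (leP x y) => ?; case: (leP (x - y) 0) => ?; lra.
Qed.

Lemma RL_max_sqr phi : RL_max (phi * phi) 0 = phi * phi.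
Proof. by RL_pointwise phi phi; rewrite max_l // -expr2 sqr_ge0. Qed.

(** Here [0 <= w <= phi^2], so [w^2] is divisible by [phi^2]. *)
Lemma RL_excess_sqr phi psi : let w := RL_max (phi * phi - RL_max psi 0) 0 in
  w * w = RL_sqr_quot w (phi * phi) * (phi * phi).
Proof.
move=> w; rewrite /w; RL_pointwise phi psi.
have := sqr_quotM (Order.max (x * x - Order.max y 0) 0) (x * x).
have x0 := sqr_ge0 x; rewrite expr2 in x0.
have y0 : 0 <= Order.max y 0 by rewrite le_max lexx orbT.
rewrite (max_r (x := Order.max _ _)) ?ge_max ?x0 ?andbT; last by lra.
by rewrite (max_l (x := Order.max _ _)) ?le_max ?lexx ?orbT // => ->.
Qed.

Lemma coz_excess phi psi :
  (coz (RL_max (phi * phi - RL_max psi 0)%R 0%R) <= coz phi)%O.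
Proof.
have /(congr1 coz) := RL_excess_sqr phi psi.
by rewrite !coz_mul !meetxx => ->; exact: leIr.
Qed.

Lemma RL_max_const (t : rat) : 0 <= t -> RL_max (RL_const t : RL L) 0 = RL_const t.
Proof. by move=> t0; RL_pointwise (1 : RL L) (1 : RL L); rewrite max_l. Qed.

End Identities.

(** * Cube roots *)

Section CubeRoot.
Local Open Scope order_scope.

Lemma ltr_cube : {mono (fun x : rat => x ^+ 3)%R : x y / x < y}.
Proof.
apply/leW_mono/le_mono => x y xy; rewrite -subr_gt0.
have -> : (y ^+ 3 - x ^+ 3 = (y - x) * ((y + x / 2) ^+ 2 + 3 / 4 * x ^+ 2))%R.
  by field.
apply: mulr_gt0; first by lra.
have [x0|x0] := eqVneq x 0%R.
  by rewrite x0 in xy *; rewrite mul0r expr0n mulr0 !addr0 exprn_gt0.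
apply: ltr_wpDl; first exact: sqr_ge0.
by apply: mulr_gt0; [lra|rewrite exprn_even_gt0].
Qed.

Lemma ler_cube : {mono (fun x : rat => x ^+ 3)%R : x y / x <= y}.
Proof. by move=> x y; rewrite !leNgt ltr_cube. Qed.

Lemma cube_max x y : (Order.max x y ^+ 3 = Order.max (x ^+ 3) (y ^+ 3) :> rat)%R.
Proof. by rewrite maxEle [in RHS]maxEle ler_cube; case: ifP. Qed.

Lemma cube_min x y : (Order.min x y ^+ 3 = Order.min (x ^+ 3) (y ^+ 3) :> rat)%R.
Proof. by rewrite minEle [in RHS]minEle ler_cube; case: ifP. Qed.

Lemma cube_above (p r : rat) : (p ^+ 3 < r)%R -> exists2 x, p < x & (x ^+ 3 <= r)%R.
Proof.
move=> pr; (* For 0 < e <= 1 the increment (p + e)^3 - p^3 is at most e * C. *)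
pose C := (3 * p ^+ 2 + 3 * `|p| + 1)%R.
have p2 := sqr_ge0 p; have ap := normr_ge0 p.
have C0 : (0 < C)%R by rewrite /C; lra.
pose e := Order.min 1%R ((r - p ^+ 3) / C)%R.
have e0 : (0 < e)%R by rewrite lt_min ltr01 divr_gt0 // subr_gt0.
have e1 : (e <= 1)%R by rewrite ge_min lexx.
have eC : (e * C <= r - p ^+ 3)%R.
  by rewrite -ler_pdivlMr // ge_min lexx orbT.
exists (p + e)%R; first by lra.
have -> : ((p + e) ^+ 3 = p ^+ 3 + e * (3 * p ^+ 2 + 3 * (p * e) + e * e))%R by ring.
suff : (3 * p ^+ 2 + 3 * (p * e) + e * e <= C)%R.
  by move=> /(ler_wpM2l (ltW e0)); lra.
have pe : (p * e <= `|p|)%R.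
  apply: le_trans (ler_norm _) _; rewrite normrM (gtr0_norm e0).
  by rewrite -[X in (_ <= X)%R]mulr1 ler_wpM2l.
have ee : (e * e <= 1 * 1)%R by apply: ler_pM => //; exact: ltW.
by rewrite /C; lra.
Qed.

Lemma cube_below (q s : rat) : (s < q ^+ 3)%R -> exists2 x, x < q & (s <= x ^+ 3)%R.
Proof.
move=> sq; have [|x qx xs] := @cube_above (- q)%R (- s)%R.
  by rewrite exprNn -signr_odd expr1 mulN1r ltrN2.
exists (- x)%R; first by lra.
by rewrite exprNn -signr_odd expr1 mulN1r lerNr.
Qed.

Context {d : Order.disp_t} {L : frameType d}.
Implicit Types phi : RL L.

(** The cube root of [phi] lies in [(p, q)] where [phi] lies in [(p^3, q^3)];
    this only uses cubes of rationals.  Cubes are cofinal on either side of a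
    rational by [cube_above] and [cube_below], which gives the relations that
    involve joins of smaller intervals. *)
Lemma cube_root_relations phi :
  real_relations (fun p q => rl_at phi (p ^+ 3)%R (q ^+ 3)%R).
Proof.
have R := rl_atP phi; split.
- by move=> p q r s; rewrite cube_max cube_min (realrel_meet R).
- move=> p q r s pr rq qs.
  by rewrite (realrel_join R) ?ler_cube ?ltr_cube.
- move=> p q; apply/eqP; rewrite eq_le; apply/andP; split; last first.
    apply: bigjoin_le => _ [r [s [pr rs sq ->]]].
    by apply: rl_at_mono; rewrite ler_cube ltW.
  rewrite (realrel_sup R); apply: bigjoin_le => _ [r [s [pr rs sq ->]]].
  have [x px xr] := cube_above pr; have [y yq sy] := cube_below sq.
  apply: (@le_bigjoint _ _ _ (rl_at phi (x ^+ 3)%R (y ^+ 3)%R)).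
    exists x, y; split=> //; rewrite -ltr_cube.
    exact: le_lt_trans xr (lt_le_trans rs sy).
  exact: rl_at_mono.
- apply/eqP; rewrite eq_le lex1 andbT (realrel_top R).
  apply: bigjoin_le => _ [p [q ->]].
  have big (x : rat) : (x <= (`|x| + 1) ^+ 3)%R.
    apply: le_trans (ler_norm x) _; have := normr_ge0 x; set y := `|x|%R => y0.
    have -> : ((y + 1) ^+ 3 = y + (y ^+ 3 + 3 * y ^+ 2 + 2 * y + 1))%R by ring.
    by have := exprn_ge0 3 y0; have := sqr_ge0 y; lra.
  apply: (@le_bigjoint _ _ _ (rl_at phi ((- (`|- p| + 1)) ^+ 3)%R ((`|q| + 1) ^+ 3)%R)).
    by exists (- (`|- p| + 1))%R, (`|q| + 1)%R.
  apply: rl_at_mono => //.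
  by rewrite exprNn -signr_odd expr1 mulN1r lerNl.
Qed.

Definition RL_cube_root phi : RL L := RL_of (cube_root_relations phi).

Lemma RL_cube_rootK phi : (RL_cube_root phi ^+ 3 = phi)%R.
Proof.
set g := RL_cube_root phi; apply: RL_disjoint_ext => p q r s pqrs.
apply/eqP; rewrite -lex0 meetC.
have cube_expr : expressed g g g (fun x y z => x * (y * z))%R (g ^+ 3)%R.
  rewrite !exprS expr0 mulr1; refine (expressed_mul _ (expressed_mul _ _)).
  - exact: expressed1.
  - exact: expressed2.
  - exact: expressed3.
apply: le_trans (leI2 (lexx _) (cube_expr p q)) _.
apply: meet_bigjoin_le => _ [a [a' [b [b' [c [c' [H ->]]]]]]].
rewrite !(realrel_meet (rl_atP g)) /g RL_ofE.
set A := Order.max _ _; set A' := Order.min _ _.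
rewrite (realrel_meet (rl_atP phi)).
have [|->//] := rl_at_itv phi (Order.max r (A ^+ 3)%R) (Order.min s (A' ^+ 3)%R).
rewrite gt_max !lt_min => /andP[/andP[rs rA'] /andP[As]].
rewrite ltr_cube => AA'; exfalso.
have inbox x : A < x < A' -> (p < x ^+ 3 < q)%R.
  rewrite /A /A' !gt_max !lt_min.
  by move=> /andP[/andP[/andP[? ?] ?] /andP[/andP[? ?] ?]]; apply: H; apply/andP.
case: pqrs => [qr|sp].
  have [x xA' rx] := cube_below rA'.
  have [y xy Ay] : exists2 y, x <= y & A < y < A'.
    have [Ax|xA] := ltP A x; first by exists x => //; rewrite Ax.
    by exists ((A + A') / 2)%R; [lra|apply/andP; split; lra].
  have /andP[_] := inbox y Ay; rewrite ltNge => /negP; apply.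
  by apply: le_trans qr (le_trans rx _); rewrite ler_cube.
have [x Ax xs] := cube_above As.
have [y yx Ay] : exists2 y, y <= x & A < y < A'.
  have [xA'|A'x] := ltP x A'; first by exists x => //; rewrite Ax.
  by exists ((A + A') / 2)%R; [lra|apply/andP; split; lra].
have /andP[+ _] := inbox y Ay; rewrite ltNge => /negP; apply.
by apply: le_trans _ (le_trans xs sp); rewrite ler_cube.
Qed.

End CubeRoot.

(** * Inverting on a complemented cozero element *)

Section PartialInverse.
Context {d : Order.disp_t} {L : frameType d}.
Local Open Scope order_scope.

Lemma pos_factor (r q : rat) : (0 < q -> 1 <= r * q -> 0 < r)%R.
Proof. by move=> q0 rq; rewrite -(pmulr_lgt0 _ q0); lra. Qed.

(** A Dedekind cut with values in [L]: [U p] plays the part of [h > p] and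
    [D q] that of [h < q]. *)
Lemma cut_relations (U D : rat -> L) :
  (forall p, U p = bigjoin [set U r | r in [set r | p < r]]) ->
  (forall q, D q = bigjoin [set D s | s in [set s | s < q]]) ->
  (forall p q, q <= p -> U p `&` D q = \bot) ->
  (forall p q, p < q -> U p `|` D q = \top) ->
  (exists p, U p = \top) -> \top = bigjoin (range D) ->
  real_relations (fun p q => U p `&` D q).
Proof.
move=> US DS UD0 UD1 [p0 Up0] D1.
have Umono p r : p <= r -> U r <= U p.
  rewrite le_eqVlt => /orP[/eqP->//|pr].
  by rewrite (US p); apply: le_bigjoin; exists r.
have Dmono s q : s <= q -> D s <= D q.
  rewrite le_eqVlt => /orP[/eqP->//|sq].
  by rewrite (DS q); apply: le_bigjoin; exists s.
have Umax p r : U p `&` U r = U (Order.max p r).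
  by case: (leP p r) => [/Umono/meet_idPr|/ltW/Umono/meet_idPl].
have Dmin q s : D q `&` D s = D (Order.min q s).
  by case: (leP q s) => [/Dmono/meet_idPl|/ltW/Dmono/meet_idPr].
split.
- by move=> p q r s; rewrite meetACA Umax Dmin.
- move=> p q r s pr rq qs; apply/eqP; rewrite eq_le; apply/andP; split.
    rewrite leUx; apply/andP; split; apply: leI2 => //; first exact: Dmono.
    exact: Umono.
  rewrite -[X in X <= _]meetx1 -(UD1 _ _ rq).
  apply: meet_join_le.
    apply: le_trans (leUr _ _); rewrite lexI leIr /=.
    by apply: leIxl; exact: leIr.
  apply: le_trans (leUl _ _); rewrite lexI leIr andbT.
  by apply: leIxl; exact: leIl.
- move=> p q; apply/eqP; rewrite eq_le; apply/andP; split; last first.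
    apply: bigjoin_le => _ [r [s [pr rs sq ->]]].
    by apply: leI2; [exact: Umono (ltW pr)|exact: Dmono (ltW sq)].
  rewrite {1}(US p) {1}(DS q).
  apply: bigjoin_meet_le => _ _ [r pr <-] [s sq <-].
  have [rs|sr] := ltP r s; last by rewrite UD0 // le0x.
  by apply: le_bigjoin; exists r, s.
- apply/eqP; rewrite eq_le lex1 andbT {1}D1.
  apply: bigjoin_le => _ [q _ <-]; rewrite -[X in X <= _]meet1x -Up0.
  by apply: le_bigjoin; exists p0, q.
Qed.

(** The hypothesis on [k] says [0 <= k].  The function [h] is [1 / k] on [coz k]
    and [0] on its complement [c]; it is continuous because [c] is open.  Hence
    [h > p], for [0 <= p], is the part of [coz k] where [k < 1 / p], and
    [h < q], for [0 < q], is the join of [c] and the part where [1 / q < k]. *)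
Lemma partial_inverse_pos (k : RL L) : (forall p, rl_at k p 0%R = \bot) ->
  complemented (coz k) -> exists h : RL L, (k * (k * h) = k)%R.
Proof.
move=> k0 /complementedP[c [ac0 ac1]].
have R := rl_atP k.
have cozE : coz k = bigjoin [set v | exists r s, (0 < r)%R /\ v = rl_at k r s].
  apply/eqP; rewrite eq_le; apply/andP; split; last first.
    by apply: bigjoin_le => _ [r [s [r0 ->]]]; apply: le_coz; right; exact: ltW.
  apply: coz_le_strict => r s rs [s0|r0].
    by apply: le_trans (le0x _); rewrite -(k0 r); apply: rl_at_mono => //; exact: ltW.
  by apply: le_bigjoin; exists r, s.
pose U p : L := if p < 0%R then \top else
  bigjoin [set v | exists r s, [/\ 0%R <= r, (s * p <= 1)%R & v = rl_at k r s]].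
pose D q : L := if q <= 0%R then \bot else
  c `|` bigjoin [set v | exists r s, (1 <= r * q)%R /\ v = rl_at k r s].
have U0 p : p < 0%R -> U p = \top by rewrite /U => ->.
have UE p : 0%R <= p -> U p =
    bigjoin [set v | exists r s, [/\ 0%R <= r, (s * p <= 1)%R & v = rl_at k r s]].
  by rewrite /U => /le_gtF->.
have D0 q : q <= 0%R -> D q = \bot by rewrite /D => ->.
have DE q : 0%R < q -> D q =
    c `|` bigjoin [set v | exists r s, (1 <= r * q)%R /\ v = rl_at k r s].
  by rewrite /D => /lt_geF->.
have rel : real_relations (fun p q => U p `&` D q).
  apply: cut_relations.
  - move=> p; apply/eqP; rewrite eq_le; apply/andP; split; last first.
      apply: bigjoin_le => _ [r /= pr <-].
      have [p0|p0] := ltP p 0%R; first by rewrite (U0 p) // lex1.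
      rewrite !UE; [|by lra..].
      apply: bigjoin_le => _ [t [s [t0 sr ->]]].
      have [ts|->] := rl_at_itv k t s; last exact: le0x.
      apply: le_bigjoin; exists t, s; split=> //; apply: le_trans sr.
      by apply: ler_wpM2l; lra.
    have [p0|p0] := ltP p 0%R.
      apply: (@le_bigjoint _ _ _ (U (p / 2)%R)).
        by exists (p / 2)%R => //=; lra.
      by rewrite (U0 (p / 2)%R) ?lex1; last lra.
    rewrite {1}UE //.
    apply: bigjoin_le => _ [r [s [r0 sp ->]]]; rewrite (realrel_sup R).
    apply: bigjoin_le => _ [r' [s' [rr rs ss ->]]].
    have s'0 : (0 < s')%R by lra.
    have ps : p < (s'^-1)%R.
      rewrite -(ltr_pM2l s'0) mulfV ?gt_eqF //.
      by move: p0; rewrite le_eqVlt => /orP[/eqP<-|p0]; [lra|nra].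
    apply: (@le_bigjoint _ _ _ (U (s'^-1)%R)); first by exists (s'^-1)%R.
    rewrite UE; last by rewrite invr_ge0 ltW.
    by apply: le_bigjoin; exists r', s'; split=> //; [lra|rewrite mulfV ?gt_eqF].
  - move=> q; apply/eqP; rewrite eq_le; apply/andP; split; last first.
      apply: bigjoin_le => _ [s /= sq <-].
      have [s0|s0] := leP s 0%R; first by rewrite D0 // le0x.
      rewrite !DE; [|by lra..].
      apply: leU2 => //; apply: bigjoin_le => _ [r [t [rs ->]]].
      apply: le_bigjoin; exists r, t; split=> //; apply: (le_trans rs).
      have r0 : (0 < r)%R by exact: pos_factor rs.
      by apply: ler_wpM2l; lra.
    have [q0|q0] := leP q 0%R; first by rewrite D0 // le0x.
    rewrite {1}DE // leUx; apply/andP; split.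
      apply: (@le_bigjoint _ _ _ (D (q / 2)%R)).
        by exists (q / 2)%R => //=; lra.
      by rewrite DE ?leUl //; lra.
    apply: bigjoin_le => _ [r [s [rq ->]]]; rewrite (realrel_sup R).
    apply: bigjoin_le => _ [r' [s' [rr rs ss ->]]].
    have r0 : (0 < r)%R by exact: pos_factor rq.
    have r'0 : (0 < r')%R by lra.
    apply: (@le_bigjoint _ _ _ (D (r'^-1)%R)).
      exists (r'^-1)%R => //=.
      by rewrite -(ltr_pM2l r'0) mulfV ?gt_eqF //; nra.
    rewrite DE ?invr_gt0 //; apply: le_trans (leUr _ _).
    by apply: le_bigjoin; exists r', s'; rewrite mulfV ?gt_eqF.
  - move=> p q qp; have [q0|q0] := leP q 0%R; first by rewrite (D0 q) // meetx0.
    rewrite UE ?DE //; last by lra.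
    apply/eqP; rewrite -lex0; apply: bigjoin_meetl_le => _ [r [s [r0 sp ->]]].
    apply: meet_join_le.
      by rewrite -ac0; apply: leI2 => //; apply: le_coz; right.
    apply: meet_bigjoin_le => _ [r' [s' [rq ->]]].
    rewrite rl_at_meet0 //; left.
    rewrite -(ler_pM2r q0); apply: le_trans rq.
    have [s0|s0] := leP s 0%R; first by nra.
    by apply: le_trans sp; apply: ler_wpM2l => //; exact: ltW.
  - move=> p q pq; apply/eqP; rewrite -le1x.
    have [p0|p0] := ltP p 0%R; first by rewrite U0 ?leUl.
    have q0 : (0 < q)%R by lra.
    rewrite UE ?DE // -ac1 leUx; apply/andP; split; last first.
      by apply: le_trans (leUr _ _); exact: leUl.
    rewrite cozE; apply: bigjoin_le => _ [r [s [r0 ->]]].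
    set V1 := bigjoin _; set V2 := bigjoin _.
    have small r' s' : (0 <= r')%R -> (s' * p <= 1)%R -> rl_at k r' s' <= V1.
      by move=> ? ?; apply: le_bigjoin; exists r', s'.
    have large r' s' : (1 <= r' * q)%R -> rl_at k r' s' <= V2.
      by move=> ?; apply: le_bigjoin; exists r', s'.
    have [sp|sp] := leP (s * p)%R 1%R.
      by apply: le_trans (leUl _ _); apply: small => //; exact: ltW.
    have p0' : (0 < p)%R.
      rewrite lt_neqAle p0 andbT; apply/eqP => p0'.
      by move: sp; rewrite -p0' mulr0; lra.
    have qp : (q^-1 < p^-1)%R by rewrite ltf_pV2 ?posrE.
    have q'0 : (0 <= q^-1)%R by rewrite invr_ge0 ltW.
    have ps : (p^-1 <= s)%R.
      by rewrite -(ler_pM2r p0') mulVf ?gt_eqF //; exact: ltW.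
    apply: (@le_trans _ _ (rl_at k 0%R s)); first by apply: rl_at_mono => //; exact: ltW.
    rewrite -(realrel_join R q'0 qp ps) leUx; apply/andP; split.
      by apply: le_trans (leUl _ _); apply: small => //; rewrite mulVf ?gt_eqF.
    apply: le_trans (leUr _ _); apply: le_trans (leUr _ _).
    by apply: large; rewrite mulVf ?gt_eqF.
  - by exists (-1)%R; rewrite U0.
  - apply/eqP; rewrite eq_le lex1 andbT -ac1 leUx; apply/andP; split; last first.
      apply: (@le_bigjoint _ _ _ (D 1%R)); first by exists 1%R.
      by rewrite DE ?leUl.
    rewrite cozE; apply: bigjoin_le => _ [r [s [r0 ->]]].
    apply: (@le_bigjoint _ _ _ (D (r^-1)%R)); first by exists (r^-1)%R.
    rewrite DE ?invr_gt0 //; apply: le_trans (leUr _ _).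
    by apply: le_bigjoin; exists r, s; rewrite mulfV ?gt_eqF.
exists (RL_of rel); set h := RL_of rel.
apply/eqP; rewrite -subr_eq0 -[X in (_ - X)%R]mulr1 -mulrBr; apply/eqP/coz_eq0.
rewrite coz_mul; apply/eqP; rewrite -lex0 {1}cozE.
apply: bigjoin_meetl_le => _ [r [s [r0 ->]]].
rewrite /coz; apply: meet_bigjoin_le => _ [p [q ->]].
have kh : expressed k h h (fun x y _ => x * y - 1)%R (k * h - 1)%R.
  refine (expressed_add (expressed_mul _ _) (expressed_opp _)).
  - exact: expressed1.
  - exact: expressed2.
  - exact: (expressed_const _ _ _ 1%R).
(* On any box inside coz k the product x * y takes values >= 1 as well as
   values <= 1, unless the box is empty; [low] and [high] show that a box where
   only one of the two sides occurs is empty. *)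
have low A A' B B' : 0%R < A -> B < B' ->
    (forall x y, A < x < A' -> B < y < B' -> x * y < 1)%R ->
    rl_at k A A' `&` D B' <= \bot.
  move=> A0 BB' H; have [B'0|B'0] := leP B' 0%R; first by rewrite D0 ?meetx0.
  rewrite DE //; apply: meet_join_le.
    by rewrite -ac0; apply: leI2 => //; apply: le_coz; right; exact: ltW.
  apply: meet_bigjoin_le => _ [r' [s' [rB ->]]].
  rewrite (realrel_meet R); have [|->//] := rl_at_itv k (Order.max A r') (Order.min A' s').
  rewrite gt_max !lt_min => /andP[/andP[AA' As'] /andP[rA' rs']]; exfalso.
  pose x := ((Order.max A r' + A') / 2)%R.
  have [x1 r'x] : A < x < A' /\ r' < x.
    by rewrite /x; case: (leP A r') => ?; split; try (apply/andP; split); lra.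
  have x0 : (0 < x)%R by case/andP: x1; lra.
  have xB : (x^-1 < B')%R by rewrite -(ltr_pM2l x0) mulfV ?gt_eqF //; nra.
  pose y := ((Order.max B x^-1 + B') / 2)%R.
  have [y1 xy] : B < y < B' /\ (x^-1 < y)%R.
    by rewrite /y; case: (leP B x^-1%R) => ?; split; try (apply/andP; split); lra.
  have := H x y x1 y1.
  have xy1 : (1 < x * y)%R by rewrite -[1%R](mulfV (lt0r_neq0 x0)) ltr_pM2l.
  by lra.
have high A A' B B' : 0%R < A -> B < B' ->
    (forall x y, A < x < A' -> B < y < B' -> 1 < x * y)%R ->
    rl_at k A A' `&` U B <= \bot.
  move=> A0 BB' H.
  have [AA'|->] := rl_at_itv k A A'; last by rewrite meet0x.
  have [B0|B0] := ltP B 0%R.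
    exfalso; pose m := ((B + Order.min 0%R B') / 2)%R.
    have [mB m0] : B < m < B' /\ (m < 0)%R.
      by rewrite /m; case: (leP 0%R B') => ?; split; try (apply/andP; split); lra.
    have x0 : (0 < (A + A') / 2)%R by lra.
    have xA : A < ((A + A') / 2)%R < A' by apply/andP; split; lra.
    by have := H _ _ xA mB; rewrite ltNge => /negP; apply; nra.
  rewrite UE //; apply: meet_bigjoin_le => _ [r' [s' [r'0 sB ->]]].
  rewrite (realrel_meet R); have [|->//] := rl_at_itv k (Order.max A r') (Order.min A' s').
  rewrite gt_max !lt_min => /andP[/andP[_ As'] /andP[rA' rs']]; exfalso.
  pose x := ((A + Order.min A' s') / 2)%R.
  have [x1 xs'] : A < x < A' /\ x < s'.
    by rewrite /x; case: (leP A' s') => ?; split; try (apply/andP; split); lra.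
  have x0 : (0 < x)%R by case/andP: x1; lra.
  have xB : (B < x^-1)%R.
    rewrite -(ltr_pM2l x0) mulfV ?gt_eqF //.
    by move: B0; rewrite le_eqVlt => /orP[/eqP<-|B0]; [lra|nra].
  pose y := ((B + Order.min B' x^-1) / 2)%R.
  have [y1 xy] : B < y < B' /\ (y < x^-1)%R.
    by rewrite /y; case: (leP B' x^-1%R) => ?; split; try (apply/andP; split); lra.
  have := H x y x1 y1.
  have xy1 : (x * y < 1)%R by rewrite -[1%R](mulfV (lt0r_neq0 x0)) ltr_pM2l.
  by lra.
apply: meet_join_le; apply: le_trans (leI2 (lexx _) (kh _ _)) _;
  apply: meet_bigjoin_le => _ [a [a' [b [b' [c1 [c1' [H ->]]]]]]];
  rewrite -(meetA (rl_at k a a')) meetA !(realrel_meet (rl_atP _)).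
- have [BB'|->] := rl_at_itv h (Order.max b c1) (Order.min b' c1'); last by rewrite meetx0.
  apply: (@le_trans _ _ (rl_at k (Order.max r a) (Order.min s a')
      `&` D (Order.min b' c1'))); first by rewrite leI2 // RL_ofE leIr.
  apply: (low _ _ (Order.max b c1)) => // [|x y]; first by rewrite lt_max r0.
  rewrite !gt_max !lt_min => /andP[/andP[? ?] /andP[? ?]].
  move=> /andP[/andP[? ?] /andP[? ?]].
  have /andP[_] : p < (x * y - 1)%R < 0%R by apply: (H x y y); apply/andP.
  by lra.
- have [BB'|->] := rl_at_itv h (Order.max b c1) (Order.min b' c1'); last by rewrite meetx0.
  apply: (@le_trans _ _ (rl_at k (Order.max r a) (Order.min s a')
      `&` U (Order.max b c1))); first by rewrite leI2 // RL_ofE leIl.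
  apply: (high _ _ _ (Order.min b' c1')) => // [|x y]; first by rewrite lt_max r0.
  rewrite !gt_max !lt_min => /andP[/andP[? ?] /andP[? ?]].
  move=> /andP[/andP[? ?] /andP[? ?]].
  have /andP[+ _] : 0%R < (x * y - 1)%R < q by apply: (H x y y); apply/andP.
  by lra.
Qed.

Lemma RL_sqr_ge0 (phi : RL L) p : rl_at (phi * phi)%R p 0%R = \bot.
Proof.
apply/eqP; rewrite -lex0; have E : expressed phi phi phi (fun x y z => x * x)%R (phi * phi)%R.
  by refine (expressed_mul _ _); exact: expressed1.
apply: le_trans (E _ _) _; apply: bigjoin_le => _ [a [a' [b [b' [c [c' [H ->]]]]]]].
have [aa'|->] := rl_at_itv phi a a'; last by rewrite !meet0x.
have [bb'|->] := rl_at_itv phi b b'; last by rewrite meetx0 meet0x.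
have [cc'|->] := rl_at_itv phi c c'; last by rewrite meetx0.
exfalso; have := H ((a + a') / 2)%R ((b + b') / 2)%R ((c + c') / 2)%R.
have mid (x y : rat) : x < y -> x < ((x + y) / 2)%R < y.
  by move=> ?; apply/andP; split; lra.
rewrite !mid // => /(_ isT isT isT)/andP[_].
by have := sqr_ge0 ((a + a') / 2)%R; rewrite expr2; lra.
Qed.

Lemma coz_complementedP (phi : RL L) :
  complemented (coz phi) <-> exists v : RL L, (phi * phi * v = phi)%R.
Proof.
split=> [phic|[v phiv]]; last first.
  apply/complementedP; exists (coz (1 - phi * v)%R); split.
    by rewrite -coz_mul mulrBr mulr1 mulrA phiv subrr coz0.
  apply/eqP; rewrite -le1x -coz1.
  rewrite -[X in coz X <= _](subrK (phi * v)%R) joinC.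
  apply: le_trans (coz_add _ _) _; apply: leU2 => //.
  by rewrite coz_mul leIl.
have [|h hE] := @partial_inverse_pos (phi * phi)%R (RL_sqr_ge0 phi).
  by rewrite coz_mul meetxx.
exists (phi * h)%R; apply/eqP; rewrite -subr_eq0; apply/eqP/coz_eq0.
apply/eqP; rewrite -lex0; set e := (_ - _)%R.
have E : (e * phi * phi * phi = 0)%R.
  have -> : (e * phi * phi * phi = (phi * phi * (phi * phi * h) - phi * phi) * phi * phi)%R.
    by rewrite /e; ring.
  by rewrite hE subrr !mul0r.
have -> : coz e = coz (e * phi * phi * phi)%R; last by rewrite E coz0.
rewrite !coz_mul -!meetA !meetxx; apply/esym/meet_idPl.
have -> : e = (phi * (phi * (phi * h) - 1))%R by rewrite /e; ring.
exact: coz_mul_le.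
Qed.

End PartialInverse.

(** * Comparing two elements *)

Section PFAlgebra.
Context {d : Order.disp_t} {L : frameType d}.
Implicit Types (f g k phi alpha : RL L) (I J : set (RL L)).
Local Open Scope order_scope.
Local Open Scope ring_scope.

(** The hypothesis says [f^2 <= t] for all positive [t].  On an interval of
    values bounded away from zero, [f^2] exceeds some [m > 0], and [t := m / 2]
    gives a contradiction. *)
Lemma RL_excess_div f : (forall t : rat, 0 < t -> RL_max (f * f - RL_const t) 0 = 0) ->
  f = 0.
Proof.
move=> ft0; apply/coz_eq0/eqP; rewrite -lex0; apply: coz_le_strict => p q pq pq0.
have [m m0 mP] : exists2 m : rat, 0 < m & forall x, p < x < q -> m <= x * x.
  case: pq0 => ?.
    by exists (q * q) => [|x /andP[? ?]]; nra.
  by exists (p * p) => [|x /andP[? ?]]; nra.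
have t0 : 0 < m / 2 by lra.
have E : expressed f f f (fun x _ _ => Order.max (x * x - m / 2) 0)
    (RL_max (f * f - RL_const (m / 2)) 0).
  by RL_express f f.
rewrite ft0 // in E.
have top1 : rl_at (0 : RL L) (- (m / 2)) (m / 2) = \top.
  by rewrite (rl_at_const 0) ifT //; apply/andP; split; lra.
rewrite -[X in (X <= _)%O]meetx1 -top1.
apply: le_trans (leI2 (lexx _) (E _ _)) _.
apply: meet_bigjoin_le => _ [a [a' [b [b' [c [c' [H ->]]]]]]].
rewrite !meetA (realrel_meet (rl_atP f)).
have [|->] := rl_at_itv f (Order.max p a) (Order.min q a'); last by rewrite !meet0x.
have [bb'|->] := rl_at_itv f b b'; last by rewrite meetx0 meet0x.
have [cc'|->] := rl_at_itv f c c'; last by rewrite meetx0.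
set A := Order.max p a; set A' := Order.min q a' => AA'; exfalso.
have mid (x y : rat) : x < y -> x < (x + y) / 2 < y.
  by move=> ?; apply/andP; split; lra.
have := mid _ _ AA'; set x := (A + A') / 2.
rewrite {1}/A {1}/A' gt_max lt_min => /andP[/andP[px ax] /andP[xq xa']].
have := H x _ _ _ (mid _ _ bb') (mid _ _ cc'); rewrite ax xa' => /(_ isT)/andP[_].
have := mP x; rewrite px xq => /(_ isT).
by case: (leP (x * x - m / 2) 0) => ? ? ?; lra.
Qed.

Lemma coz_max_const f (t : rat) : 0 < t -> coz (RL_max (RL_const t) f) = \top.
Proof.
move=> t0; apply/eqP; rewrite -le1x.
have t1 : t != 0 by rewrite gt_eqF.
have := RL_sqr_quotM (RL_const t) f; rewrite (RL_max_const (ltW t0)) => /(congr1 coz).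
by rewrite !coz_mul coz_const // meetxx => <-; exact: leIr.
Qed.

(** Take [w := (f^2 - t)^+] and [f' := f * (t - f^2)^+], with [t] so small that
    [w] is nonzero.  The cozero element of [f'] is the part of [coz f] where
    [f^2 < t].  Were it complemented, its complement would meet the open set
    [f^2 < t] in an open complement of [coz f]. *)
Lemma shrink_coz f : ~ complemented (coz f) -> exists f' w,
  [/\ ~ complemented (coz f'), (coz f' <= coz f)%O, (coz w <= coz f)%O,
      w * f' = 0 & w <> 0].
Proof.
move=> fN.
have [t [t0 wN]] : exists t : rat, 0 < t /\ RL_max (f * f - RL_const t) 0 <> 0.
  apply: contrapT => H; apply: fN; suff -> : f = 0.
    by apply/coz_complementedP; exists 0; rewrite mulr0.
  apply: RL_excess_div => t t0; apply: contrapT => ?; apply: H; by exists t.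
pose c : RL L := RL_const t.
pose y := RL_max (c - f * f) 0; pose w := RL_max (f * f - c) 0.
have ffc : (coz w <= coz f)%O.
  by have := coz_excess f c; rewrite /c (RL_max_const (ltW t0)).
exists (f * y), w; split=> //; last 1 first.
- rewrite mulrCA.
  suff -> : w * y = 0 by rewrite mulr0.
  exact: RL_excess_mul.
- move=> fyc; apply: fN.
  have [e [e0 e1]] := (complementedP _).1 fyc.
  have fy1 : (coz f `|` coz y)%O = \top.
    apply/eqP; rewrite -le1x -(coz_max_const (f * f) t0) RL_excess.
    by apply: le_trans (coz_add _ _) _; rewrite coz_mul meetxx.
  apply/complementedP; exists (e `&` coz y)%O; split.
    by rewrite (meetC e) meetA -coz_mul e0.
  have fe1 : (coz f `|` e)%O = \top.
    by apply/eqP; rewrite -le1x -e1; apply: leU2 => //; rewrite coz_mul leIl.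
  apply/eqP; rewrite -le1x -[X in (X <= _)%O]meetxx -{1}fe1 -fy1.
  apply: meet_join_le; first by apply: le_trans (leIr _ _) (leUl _ _).
  rewrite meetC; apply: meet_join_le; last by rewrite meetC leUr.
  by apply: le_trans (leIr _ _) (leUl _ _).
- by rewrite coz_mul leIl.
Qed.

(** [f] divides the idempotent [e], and off [e] the element [f] is, up to a
    fourth power, a multiple of [g].  The fourth power costs nothing where only
    cozero elements matter, and elsewhere it is absorbed by taking roots. *)
Definition dominated f g := exists e h,
  [/\ e * e = e, exists u, e = u * f & (1 - e) * f ^+ 4 = h * g].

Lemma PF_dominated f g : PF_frame L -> dominated f g \/ dominated g f.
Proof.
have half (j k : RL L) : complemented (coz (RL_max (k * k - j * j) 0)) -> dominated k j.
  set x := RL_max _ _ => /coz_complementedP[v xv].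
  have xk : x * x = RL_sqr_quot x (k * k) * (k * k).
    by have := RL_excess_sqr k (j * j); rewrite RL_max_sqr.
  have xvx : (1 - x * v) * x = 0 by rewrite mulrBl mul1r mulrAC xv subrr.
  exists (x * v), ((1 - x * v) * RL_sqr_quot (k * k) (j * j) * j); split.
  - by rewrite -[in RHS]xv; ring.
  - exists (v * v * RL_sqr_quot x (k * k) * k).
    rewrite -{1}xv xk; ring.
  - have := RL_sqr_quotM (k * k) (j * j); rewrite RL_max_sqr RL_excess -/x => E.
    have -> : k ^+ 4 = k * k * (k * k) by ring.
    rewrite -E; set Q := RL_sqr_quot _ _.
    have -> : (1 - x * v) * (Q * (j * j + x)) =
        (1 - x * v) * Q * j * j + Q * ((1 - x * v) * x) by ring.
    by rewrite xvx mulr0 addr0.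
move=> PF.
have ab0 : coz (RL_max (f * f - g * g) 0) `&` coz (RL_max (g * g - f * f) 0) = \bot.
  by rewrite -coz_mul RL_excess_mul coz0.
have [] := PF _ _ (ex_intro2 _ _ _ I erefl) (ex_intro2 _ _ _ I erefl) ab0.
  by left; apply: half.
by right; apply: half.
Qed.

End PFAlgebra.

(** * z_r-ideals *)

Section ZrIdeals.
Context {d : Order.disp_t} {L : frameType d}.
Implicit Types (f g k phi alpha : RL L) (I J K : set (RL L)).
Local Open Scope order_scope.
Local Open Scope ring_scope.

Lemma regularM phi psi : regular phi -> regular psi -> regular (phi * psi).
Proof. by move=> pr qr x; rewrite -mulrA => /pr/qr. Qed.

Lemma regular1 : regular (1 : RL L).
Proof. by move=> x; rewrite mul1r. Qed.

Lemma regular_annihilator alpha phi k : regular phi ->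
  coz (alpha * phi) `&` coz k = \bot -> k * alpha = 0.
Proof. by move=> pr; rewrite -coz_mul => /coz_eq0 E; apply: pr; rewrite -E; ring. Qed.

Lemma zr_idealP I : ideal I -> zr_ideal I <->
  forall f alpha phi, regular phi -> I f -> (coz (alpha * phi) <= coz f)%O -> I alpha.
Proof.
move=> Ii; have [I0 ID IM] := Ii; split=> [[[_ Iz] [_ Ir]] f alpha phi pr If le|H].
  apply: (Ir _ _ pr); apply: (Iz _ (alpha * phi * f)); first exact: IM.
  by rewrite [RHS]coz_mul; apply/esym/meet_idPl.
split; split=> //.
- move=> alpha phi Iphi E; apply: (H phi alpha 1) => //; first exact: regular1.
  by rewrite mulr1 E.
- by move=> alpha phi pr Iap; apply: (H (alpha * phi) alpha phi).
Qed.

Lemma not_zr_ideal I : ideal I -> ~ zr_ideal I -> exists f alpha phi,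
  [/\ regular phi, I f, (coz (alpha * phi) <= coz f)%O & ~ I alpha].
Proof.
move=> Ii H; apply: contrapT => N; apply: H; apply/(zr_idealP Ii).
move=> f alpha phi pr If le; apply: contrapT => ?; apply: N.
by exists f, alpha, phi.
Qed.

Lemma ideal_sum_ideal I J : ideal I -> ideal J -> ideal (ideal_sum I J).
Proof.
move=> [I0 ID IM] [J0 JD JM]; split.
- by exists 0, 0; rewrite addr0.
- move=> _ _ [x [y [Ix Jy ->]]] [x' [y' [Ix' Jy' ->]]].
  by exists (x + x'), (y + y'); rewrite addrACA; split; [exact: ID|exact: JD|].
- move=> a _ [x [y [Ix Jy ->]]]; exists (a * x), (a * y).
  by rewrite mulrDr; split; [exact: IM|exact: JM|].
Qed.

Lemma ideal_sumC I J : ideal_sum I J = ideal_sum J I.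
Proof.
by apply/seteqP; split=> _ [x [y [? ? ->]]]; exists y, x; rewrite addrC.
Qed.

Lemma ideal_suml I J f : ideal J -> I f -> ideal_sum I J f.
Proof. by case=> J0 _ _ If; exists f, 0; rewrite addr0. Qed.

Lemma ideal_sumr I J f : ideal I -> J f -> ideal_sum I J f.
Proof. by rewrite ideal_sumC; exact: ideal_suml. Qed.

Definition principal f : set (RL L) := [set g | exists u, g = u * f].

Lemma principal_ideal f : ideal (principal f).
Proof.
split.
- by exists 0; rewrite mul0r.
- by move=> _ _ [u ->] [v ->]; exists (u + v); rewrite mulrDl.
- by move=> a _ [u ->]; exists (a * u); rewrite mulrA.
Qed.

Lemma principal_refl f : principal f f.
Proof. by exists 1; rewrite mul1r. Qed.

(** The smallest z_r-ideal containing [f]. *)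
Definition zr_closure f : set (RL L) :=
  [set alpha | exists2 phi, regular phi & (coz (alpha * phi) <= coz f)%O].

Lemma zr_closure_zr f : zr_ideal (zr_closure f).
Proof.
have Zi : ideal (zr_closure f).
  split.
  - by exists 1; [exact: regular1|rewrite mul0r coz0 le0x].
  - move=> x y [phi pr xf] [psi qr yf]; exists (phi * psi); first exact: regularM.
    have -> : (x + y) * (phi * psi) = x * phi * psi + y * psi * phi by ring.
    apply: le_trans (coz_add _ _) _; rewrite leUx.
    by apply/andP; split; apply: le_trans (coz_mul_le _ _) _.
  - move=> a x [phi pr xf]; exists phi => //.
    by rewrite -mulrA mulrC; apply: le_trans (coz_mul_le _ _) xf.
apply/(zr_idealP Zi) => g alpha phi pr [psi qr gf] le.
exists (phi * psi); first exact: regularM.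
rewrite mulrA coz_mul; apply: le_trans (leI2 le (lexx _)) _.
by rewrite -coz_mul.
Qed.

Lemma zr_closure_refl f : zr_closure f f.
Proof. by exists 1; [exact: regular1|rewrite mulr1]. Qed.

(** With [f = f^2 * v], the element [1 - f * v] annihilates [f], hence
    [alpha * phi], hence [alpha] as [phi] is regular; so [alpha = alpha * v * f]. *)
Lemma complemented_absorb I f alpha phi : ideal I -> I f -> regular phi ->
  (coz (alpha * phi) <= coz f)%O -> complemented (coz f) -> I alpha.
Proof.
move=> [_ _ IM] If pr le /coz_complementedP[v fv].
have : (1 - f * v) * alpha = 0.
  apply: (regular_annihilator pr); apply/eqP; rewrite -lex0.
  apply: le_trans (leI2 le (lexx _)) _.
  by rewrite -coz_mul mulrBr mulr1 mulrA fv subrr coz0.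
move/eqP; rewrite mulrBl mul1r subr_eq0 => /eqP ->.
have -> : f * v * alpha = v * alpha * f by ring.
exact: IM.
Qed.

(** For [f = g^3] and [g = u * f], the identity [g = u * g^3] makes [g] von
    Neumann regular. *)
Lemma complemented_of_cube_root I f : zr_ideal I -> I f ->
  (forall g, I g -> (coz g <= coz f)%O -> principal f g) -> complemented (coz f).
Proof.
move=> Izr If pf; have [[Ii _] _] := Izr; set g := RL_cube_root f.
have fE : g ^+ 3 = f by exact: RL_cube_rootK.
have gf : coz g = coz f by rewrite -fE coz_exp.
have Ig : I g.
  apply: ((zr_idealP Ii).1 Izr f g 1) => //; first exact: regular1.
  by rewrite mulr1 gf.
have [|u gu] := pf g Ig; first by rewrite gf.
rewrite -gf; apply/coz_complementedP; exists (u * g).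
by rewrite [RHS]gu -fE; ring.
Qed.

(** The comparison of [f] in [I] with [g] in [J] is useful because
    [(1 - e) * f^4], a multiple of both, lies in [I `&` J]. *)
Lemma PF_intersection I J : PF_frame L -> ideal I -> ideal J ->
  zr_ideal (I `&` J)%classic -> zr_ideal I \/ zr_ideal J.
Proof.
move=> PF Ii Ji IJzr; apply: contrapT => /not_orP[In Jn].
have [f [alpha [phi [pr If af aI]]]] := not_zr_ideal Ii In.
have [g [beta [psi [qr Jg bg bJ]]]] := not_zr_ideal Ji Jn.
have [[IJi _] _] := IJzr; have IJ := (zr_idealP IJi).1 IJzr.
have half (A B : set (RL L)) (f' g' a p : RL L) : ideal A -> ideal B ->
    (forall x, A x -> B x -> (I `&` J)%classic x) -> (I `&` J `<=` A)%classic -> A f' -> B g' ->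
    regular p -> (coz (a * p) <= coz f')%O -> dominated f' g' -> A a.
  move=> [_ AD AM] [_ BD BM] AB ABA Af Bg pr' af' [e [h [ee [u eu] eh]]].
  have -> : a = a * e + (1 - e) * a by ring.
  apply: AD; first by rewrite eu mulrA; exact: AM.
  apply: ABA; apply: (IJ ((1 - e) * f' ^+ 4) _ p) => //.
    apply: AB; first by rewrite exprSr mulrA; exact: AM.
    by rewrite eh; exact: BM.
  by rewrite -mulrA coz_mul [X in (_ <= X)%O]coz_mul coz_exp leI2.
case: (PF_dominated f g PF) => H.
  by apply: aI; apply: (half I J f g alpha phi) => //; move=> x [].
by apply: bJ; apply: (half J I g f beta psi) => //; move=> x [].
Qed.

Lemma PF_sum I J : PF_frame L -> zr_ideal I -> zr_ideal J -> zr_ideal (ideal_sum I J).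
Proof.
move=> PF Izr Jzr; have [[Ii _] _] := Izr; have [[Ji _] _] := Jzr.
apply/(zr_idealP (ideal_sum_ideal Ii Ji)) => _ alpha phi pr [i [j [Ii' Jj ->]]] le.
have half (A B : set (RL L)) a b : ideal A -> zr_ideal B -> A a -> B b ->
    (coz (alpha * phi) <= coz (a + b))%O -> dominated a b -> ideal_sum A B alpha.
  move=> [_ AD AM] Bzr Aa Bb aab [e [h [ee [u eu] eh]]].
  have [[Bi _] _] := Bzr.
  exists (alpha * e), ((1 - e) * alpha); split; last by ring.
    by rewrite eu mulrA; exact: AM.
  apply: ((zr_idealP Bi).1 Bzr b _ phi) => //.
  rewrite -mulrA coz_mul; apply: le_trans (leI2 (lexx _) aab) _.
  apply: le_trans (leI2 (lexx _) (coz_add _ _)) _.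
  apply: meet_join_le; last exact: leIr.
  by rewrite -(coz_exp a 3) -coz_mul eh coz_mul leIr.
case: (PF_dominated i j PF) => H; first exact: (half I J i j).
by rewrite ideal_sumC; apply: (half J I j i) => //; rewrite addrC.
Qed.

(** Let [b] be the witness against [B], with ninth root [k' + l'], [k'] in [A]
    and [l'] in [B].  Modulo [B], the element [(1 - e) * b] is
    [(1 - e) * k'^9], a multiple of some [j'] in [B]; so [e * b] is not in [B].
    As [e] is in [A], the witness [a] against [A] has [(1 - e) * a] not in [A].
    By [complemented_absorb] neither [(1 - e) * f'] nor [e * g'] has a
    complemented cozero element, though these are disjoint. *)
Lemma PF_summand I J : PF_frame L -> ideal I -> ideal J ->
  zr_ideal (ideal_sum I J) -> zr_ideal I \/ zr_ideal J.
Proof.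
move=> PF Ii Ji Kzr; apply: contrapT => /not_orP[In Jn].
have [f [alpha [phi [pr If af aI]]]] := not_zr_ideal Ii In.
have [g [beta [psi [qr Jg bg bJ]]]] := not_zr_ideal Ji Jn.
have [[Ki _] _] := Kzr; have K := (zr_idealP Ki).1 Kzr.
have root a p c : regular p -> (coz (a * p) <= coz c)%O -> ideal_sum I J c ->
    exists i j, [/\ I i, J j & a = (i + j) ^+ 9].
  move=> pr' ac Kc; pose r := RL_cube_root (RL_cube_root a).
  have rE : r ^+ 9 = a by rewrite (exprM r 3 3) !RL_cube_rootK.
  have [|i [j [Ii' Jj rij]]] := K c r p pr' Kc.
    by rewrite coz_mul -(coz_exp r 8) rE -coz_mul.
  by exists i, j; rewrite -rij rE.
have [i [j [Ii' Jj aE]]] := root alpha phi f pr af (ideal_suml Ji If).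
have [k [l [Ik Jl bE]]] := root beta psi g qr bg (ideal_sumr Ii Jg).
have half (A B : set (RL L)) (a b f' g' p q k' j' l' : RL L) : ideal A -> ideal B ->
    A f' -> B g' -> ~ A a -> ~ B b -> regular p -> regular q ->
    (coz (a * p) <= coz f')%O -> (coz (b * q) <= coz g')%O ->
    A k' -> B j' -> B l' -> b = (k' + l') ^+ 9 -> dominated k' j' -> False.
  move=> Ai Bi Af Bg Aa Bb pr' qr' af' bg' Ak Bj Bl bE' [e [h [ee [u eu] eh]]].
  have [_ AD AM] := Ai; have [_ BD BM] := Bi.
  have Ae : A e by rewrite eu; exact: AM.
  have Be : B ((1 - e) * b).
    have -> : (1 - e) * b =
        h * k' ^+ 5 * j' + (1 - e) * ((k' + l') ^+ 9 - k' ^+ 9).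
      have -> : h * k' ^+ 5 * j' = (1 - e) * k' ^+ 9.
        by rewrite mulrAC -eh -mulrA -exprD.
      by rewrite bE'; ring.
    apply: BD; first exact: BM.
    rewrite subrXX; set S := \sum_(_ < _) _.
    have -> : (1 - e) * ((k' + l' - k') * S) = (1 - e) * S * l' by ring.
    exact: BM.
  have disj : coz ((1 - e) * f') `&` coz (e * g') = \bot.
    by rewrite -coz_mul mulrACA mulrBl mul1r ee subrr mul0r coz0.
  case: (PF _ _ (ex_intro2 _ _ _ Logic.I erefl) (ex_intro2 _ _ _ Logic.I erefl) disj) => c.
  - apply: Aa; have -> : a = a * e + (1 - e) * a by ring.
    apply: AD; first exact: AM.
    apply: (complemented_absorb Ai _ pr' _ c); first exact: AM.
    by rewrite -mulrA !coz_mul -coz_mul leI2.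
  - apply: Bb; have -> : b = e * b + (1 - e) * b by ring.
    apply: BD => //.
    apply: (complemented_absorb Bi _ qr' _ c); first exact: BM.
    by rewrite -mulrA !coz_mul -coz_mul leI2.
case: (PF_dominated k j PF) => H.
  exact: (half I J alpha beta f g phi psi k j l).
apply: (half J I beta alpha g f psi phi j k i) => //.
by rewrite addrC.
Qed.

Lemma intersection_PF : (forall I J, ideal I -> ideal J ->
    zr_ideal (I `&` J)%classic -> zr_ideal I \/ zr_ideal J) -> PF_frame L.
Proof.
move=> H _ _ [f _ <-] [g _ <-] fg0.
have fg : f * g = 0 by apply/coz_eq0; rewrite coz_mul.
have IJ0 : (principal f `&` principal g)%classic = zr_closure 0.
  (* As f * g = 0, an element of both principal ideals has square zero. *)
  apply/seteqP; split=> x.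
    move=> [[u xu] [v xv]]; suff -> : x = 0 by have [[[]]] := zr_closure_zr 0.
    apply: sqr_eq0; rewrite {1}xu xv.
    have -> : u * f * (v * g) = u * v * (f * g) by ring.
    by rewrite fg mulr0.
  move=> [phi pr]; rewrite coz0 lex0 => /eqP/coz_eq0; rewrite mulrC => /pr ->.
  by split; exists 0; rewrite mul0r.
have := H _ _ (principal_ideal f) (principal_ideal g).
rewrite IJ0 => /(_ (zr_closure_zr 0)) [] Z; [left|right].
  exact: (complemented_of_cube_root Z (principal_refl f)).
exact: (complemented_of_cube_root Z (principal_refl g)).
Qed.

Lemma sum_PF :
  (forall I J, zr_ideal I -> zr_ideal J ->
     zr_ideal (ideal_sum I J) \/ ideal_sum I J = setT) ->
  (forall I J, ideal I -> ideal J ->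
     zr_ideal (ideal_sum I J) -> ideal_sum I J <> setT ->
     zr_ideal I \/ zr_ideal J) -> PF_frame L.
Proof.
move=> H1 H2 _ _ [f _ <-] [g _ <-] fg0; apply: contrapT => /not_orP[fN gN].
have [f' [w [f'N f'f wf wf' w0]]] := shrink_coz fN.
have f'g0 : coz f' `&` coz g = \bot.
  by apply/eqP; rewrite -lex0 -fg0 leI2.
have closure_ideal k : ideal (zr_closure k) by case: (zr_closure_zr k) => -[].
(* The sum is proper, being annihilated by w. *)
have Sn : ideal_sum (zr_closure f') (zr_closure g) <> setT.
  move=> /(congr1 (fun S => S 1)) /= S1.
  have [x [y [[phi pr xf] [psi qr yg] xy1]]] :
    ideal_sum (zr_closure f') (zr_closure g) 1 by rewrite S1.
  apply: w0; rewrite -[w]mulr1 xy1 mulrDr.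
  have -> : w * x = 0.
    apply: (regular_annihilator pr); apply/eqP; rewrite -lex0.
    by apply: le_trans (leI2 xf (lexx _)) _; rewrite -coz_mul mulrC wf' coz0.
  rewrite add0r; apply: (regular_annihilator qr); apply/eqP; rewrite -lex0.
  by rewrite -fg0 meetC leI2.
have Szr : zr_ideal (ideal_sum (zr_closure f') (zr_closure g)).
  by case: (H1 _ _ (zr_closure_zr f') (zr_closure_zr g)).
(* The cube root of p lies in the ideal; its component in the closure of q has a
   cozero element below both coz p and coz q. *)
have half p q : coz p `&` coz q = \bot ->
    zr_ideal (ideal_sum (principal p) (zr_closure q)) -> complemented (coz p).
  move=> pq0 Z; apply: (complemented_of_cube_root Z).
    by apply: ideal_suml; last exact: principal_refl.
  move=> x [_ [y [[u ->] [phi pr yq] xE]]] xp; exists u.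
  rewrite xE (_ : y = 0) ?addr0 //; apply: sqr_eq0.
  apply: (regular_annihilator pr); apply/eqP; rewrite -lex0 -pq0 meetC leI2 //.
  have -> : y = x - u * p by rewrite xE; ring.
  apply: le_trans (coz_add _ _) _; rewrite leUx xp -mulNr.
  by rewrite mulrC coz_mul_le.
have eqS : ideal_sum (ideal_sum (principal f') (zr_closure g))
    (ideal_sum (principal g) (zr_closure f')) =
    ideal_sum (zr_closure f') (zr_closure g).
  apply/seteqP; split=> z.
    move=> [_ [_ [[_ [y [[u ->] Zy ->]]] [_ [x [[v ->] Zx ->]]] ->]]].
    have [_ FD FM] := closure_ideal f'; have [_ GD GM] := closure_ideal g.
    exists (u * f' + x), (v * g + y); split; last by ring.
      by apply: FD => //; apply: FM; exact: zr_closure_refl.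
    by apply: GD => //; apply: GM; exact: zr_closure_refl.
  move=> [x [y [Zx Zy ->]]]; exists y, x; split; last by rewrite addrC.
    by apply: ideal_sumr => //; exact: principal_ideal.
  by apply: ideal_sumr => //; exact: principal_ideal.
have := H2 (ideal_sum (principal f') (zr_closure g))
  (ideal_sum (principal g) (zr_closure f')).
rewrite eqS => /(_ (ideal_sum_ideal (principal_ideal _) (closure_ideal _)))
  /(_ (ideal_sum_ideal (principal_ideal _) (closure_ideal _)) Szr Sn) [].
- by move/(half _ _ f'g0).
- by rewrite meetC in f'g0; move/(half _ _ f'g0).
Qed.

End ZrIdeals.

Theorem corollary5p6 (d : Order.disp_t) (L : frameType d)
    (hL : completely_regular L) :
  [<->
    (forall I J : set (RL L), zr_ideal I -> zr_ideal J ->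
       zr_ideal (ideal_sum I J) \/ ideal_sum I J = setT) /\
    (forall I J : set (RL L), ideal I -> ideal J ->
       zr_ideal (ideal_sum I J) -> ideal_sum I J <> setT ->
       zr_ideal I \/ zr_ideal J);
    PF_frame L;
    forall I J : set (RL L), ideal I -> ideal J ->
      zr_ideal (I `&` J)%classic -> zr_ideal I \/ zr_ideal J].
Proof.
tfae.
- by case; exact: sum_PF.
- by move=> PF I J; exact: PF_intersection.
- move=> /intersection_PF PF; split=> I J; first by left; exact: PF_sum.
  by move=> Ii Ji Kzr _; exact: PF_summand.
Qed.
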